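(* Let $k\neq h$. Assume that $f,g\in L^1(\mathbb R^3)\cap L^2(\mathbb R^3)$, and that $f$ is supported in $\{|\bar x|\geq \gamma_2R\}$ while $g$ is supported in $\{|\bar x|\leq \gamma_1R\}$, for some $\gamma_1,\gamma_2>0$ satisfying $d:=\gamma_2-\gamma_1>0$. Then $$|\langle \mathcal R_k^2\mathcal R_h^2 f,g\rangle|\lesssim R^{-1}\|g\|_{L^1}\|f\|_{L^1}.$$
   Context: All functions are defined on $\mathbb R^3$. For $x=(x_1,x_2,x_3)\in\mathbb R^3$, write $\bar x=(x_1,x_2)$ and $|\bar x|=(x_1^2+x_2^2)^{1/2}$. $R>0$ is the parameter fixing the radii of the cylinders. $\langle\cdot,\cdot\rangle$ is the usual $L^2(\mathbb R^3)$ inner product. $\mathcal R_j$, $j\in\{1,2,3\}$, is the $j$-th Riesz transform on $\mathbb R^3$, and, for $k,h\in\{1,2,3\}$, $\mathcal R_k^2\mathcal R_h^2$ is the Fourier multiplier operator with symbol $\xi_k^2\xi_h^2/|\xi|^4$. The symbol $\lesssim$ denotes inequality up to a positive multiplicative constant.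
   Formalization: The constant is uniform in f, g and in all R at least R_0, for each fixed R_0 > 0 (it may depend on R_0, k, h and the gammas); one constant for all R > 0 is impossible, since by scaling the bound decays exactly like R^{-3} and fails as R tends to 0. *)

(* Defs.v *)
From HB Require Import structures.
From mathcomp Require Import all_boot all_order all_algebra complex.
From mathcomp Require Import all_classical all_reals all_analysis.

Set Implicit Arguments.
Unset Strict Implicit.
Unset Printing Implicit Defensive.

Import Order.TTheory GRing.Theory Num.Theory.
Import numFieldNormedType.Exports.

Local Open Scope classical_set_scope.
Local Open Scope ring_scope.
Local Open Scope complex_scope.

(* R^3 with its Borel sigma-algebra; a point is ((x1, x2), x3). *)
Notation space3 R :=
  (measurableTypeR R * measurableTypeR R * measurableTypeR R)%type.

Notation leb3 R :=
  ((@lebesgue_measure R \x @lebesgue_measure R) \x @lebesgue_measure R)%E.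

Notation cmod := ComplexField.Normc.normc.

Section Space.
Variable R : realType.
Implicit Types x y : space3 R.

Definition coord (j : 'I_3) x : R := tnth [tuple x.1.1; x.1.2; x.2] j.

Definition dot x y : R := \sum_(j < 3) coord j x * coord j y.

Definition enorm x : R := Num.sqrt (dot x x).

Definition cylnorm x : R := Num.sqrt (x.1.1 ^+ 2 + x.1.2 ^+ 2).

End Space.

Section FunctionSpaces.
Variable R : realType.
Implicit Types f g : space3 R -> R[i].

(* The library integrates real functions only: integrate componentwise. *)
Definition cintegral (D : set (space3 R)) f : R[i] :=
  (\int[leb3 R]_(x in D) complex.Re (f x))
  +i* (\int[leb3 R]_(x in D) complex.Im (f x)).

Definition Lp_norm (p : R) f : \bar R :=
  Lnorm (leb3 R) p%:E (fun x => (cmod (f x))%:E).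

Definition in_Lp (p : R) f : Prop :=
  [/\ measurable_fun setT (fun x => complex.Re (f x)),
      measurable_fun setT (fun x => complex.Im (f x)) &
      (Lp_norm p f < +oo)%E].

Definition inner f g : R[i] := cintegral setT (fun x => f x * (g x)^*).

(* Support of an a.e. class; for closed [A] this says that the essential
   support of [f] is contained in [A]. *)
Definition supported_in (A : set (space3 R)) f : Prop :=
  {ae leb3 R, forall x, ~ A x -> f x = 0}.

End FunctionSpaces.

Section FourierMultipliers.
Variable R : realType.
Implicit Types f F u : space3 R -> R[i].

(* The integral of f(x) exp(2 pi i s <x, xi>) over the ball |x| <= n;
   s = -1 is the Fourier transform and s = 1 the inverse one. *)
Definition trunc_fourier (s : R) (n : nat) f (xi : space3 R) : R[i] :=
  cintegral [set x | enorm x <= n%:R]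
    (fun x => let t := 2 * pi * s * dot x xi in f x * (cos t +i* sin t)).

(* [F] is (a representative of) the L^2 Fourier transform of [f]: the limit in
   the L^2 norm of the transforms of the truncations of [f], which are
   integrable. *)
Definition is_fourier_L2 (s : R) f F : Prop :=
  [/\ in_Lp 2 f, in_Lp 2 F &
      (fun n => Lp_norm 2 (fun xi => F xi - trunc_fourier s n f xi))
        @ \oo --> 0%E].

(* [u] is (a representative of) the image of [f] under the operator on L^2
   with symbol [m]: the inverse Fourier transform of [m] times the Fourier
   transform of [f]. *)
Definition is_fourier_multiplier (m : space3 R -> R) f u : Prop :=
  exists2 F, is_fourier_L2 (-1) f F &
             is_fourier_L2 1 (fun xi => (m xi)%:C * F xi) u.

(* The symbol of R_k^2 R_h^2. It is homogeneous of degree 0, so the operator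
   does not depend on the normalization of the Fourier transform. At the null
   set {0} its value is 0. *)
Definition riesz_symbol (k h : 'I_3) (xi : space3 R) : R :=
  (coord k xi ^+ 2 * coord h xi ^+ 2) / enorm xi ^+ 4.

End FourierMultipliers.

(* Main.v *)
Require Import Defs.
From HB Require Import structures.
From mathcomp Require Import all_boot all_order all_algebra complex.
From mathcomp Require Import all_classical all_reals all_analysis.
From mathcomp Require Import measurable_realfun ring lra.

(** The operator has the kernel of a homogeneous multiplier of degree 0, which
    decays like the inverse cube of the distance. Points of the two supports are
    at distance at least [(gamma2 - gamma1) * rho], so the pairing is at most a
    constant times [rho ^- 3] times the two integral norms, and
    [rho ^- 3 <= rho0 ^- 2 * rho^-1]. The work is to make sense of the kernel,
    since the symbol is not integrable.

    The symbol is a superposition of integrable Gaussian weights: the integral of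
    [2 * s ^+ 3 * (xi_k * xi_h) ^+ 2 * exp (- s ^+ 2 * |xi| ^+ 2)] over [s] in
    [[a, b]] is the symbol times a smooth spectral cutoff with values in [[0, 1]],
    which tends to 1 as [a] goes to 0 and [b] to infinity ([subordination]). A
    Gaussian weight is a product of functions of one coordinate, so its kernel is
    a product of one-dimensional Fourier transforms of polynomials times
    Gaussians. Integrating by parts four times bounds these by a constant times
    [s^-1 / (1 + (w / s) ^+ 4)] at frequency [w] ([wave_decay]). At distance
    [delta] the weight of parameter [s] therefore contributes at most a constant
    times [(s ^+ 4 + delta ^+ 4)^-1], and the integral over [s] of this is of order
    [delta ^- 3], uniformly in the cutoff ([off_diagonal]).

    It remains to connect this with the operator, which is defined by limits in
    square norm. If [F] is the Fourier transform of [f], moving the inverse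
    transform onto [g] expresses the inner product of [u] and [g] as the integral
    of the symbol times [F] times the conjugate of the Fourier transform of [g]
    ([inner_multiplier]). This needs the transform of [g] to be square integrable,
    which follows from the same kernel bounds applied to the plain Gaussian, by
    Schur's test and monotone convergence ([csquare_integrable_fourier]). The bound
    is proved for the truncations of [f] with the spectral cutoff in place; it
    passes to [F] by the Cauchy-Schwarz inequality and then survives the removal of
    the cutoff by dominated convergence ([multiplier_pairing_le]). *)

Import Order.TTheory GRing.Theory Num.Theory.
Import numFieldNormedType.Exports.

Set Implicit Arguments.
Unset Strict Implicit.
Unset Printing Implicit Defensive.

Local Open Scope classical_set_scope.
Local Open Scope ring_scope.

(** * Complex-valued functions and their integrals *)

Section ComplexModulus.
Variable R : realType.
Implicit Types (z w : R[i]) (t : R).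

Lemma cmodE z : cmod z = Num.sqrt (complex.Re z ^+ 2 + complex.Im z ^+ 2).
Proof. by case: z. Qed.

Lemma cmod_ge0 z : 0 <= cmod z.
Proof. by rewrite cmodE sqrtr_ge0. Qed.

Lemma sqr_cmod z : cmod z ^+ 2 = complex.Re z ^+ 2 + complex.Im z ^+ 2.
Proof. by rewrite cmodE sqr_sqrtr // addr_ge0 // sqr_ge0. Qed.

Lemma normr_Re_le z : `|complex.Re z| <= cmod z.
Proof. by rewrite cmodE -sqrtr_sqr ler_sqrt ?addr_ge0 ?sqr_ge0// lerDl sqr_ge0. Qed.

Lemma normr_Im_le z : `|complex.Im z| <= cmod z.
Proof. by rewrite cmodE -sqrtr_sqr ler_sqrt ?addr_ge0 ?sqr_ge0// lerDr sqr_ge0. Qed.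

Lemma cmod_le_add z : cmod z <= `|complex.Re z| + `|complex.Im z|.
Proof.
rewrite cmodE -[leRHS]ger0_norm ?addr_ge0// -sqrtr_sqr ler_sqrt ?sqr_ge0//.
by rewrite sqrrD !real_normK ?num_real// lerD2r lerDl mulrn_wge0// mulr_ge0.
Qed.

Lemma cmod_conj z : cmod (z^*)%C = cmod z.
Proof. by case: z => a b /=; rewrite sqrrN. Qed.

Lemma cmod_real (x : R) : cmod (x%:C)%C = `|x|.
Proof. by rewrite cmodE/= expr0n/= addr0 sqrtr_sqr. Qed.

Lemma cmodM z w : cmod (z * w) = cmod z * cmod w.
Proof. exact: ComplexField.Normc.normcM. Qed.

Lemma cmodD z w : cmod (z + w) <= cmod z + cmod w.
Proof. exact: le_normcD. Qed.

Lemma cmodN z : cmod (- z) = cmod z.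
Proof. exact: normcN. Qed.

Lemma cmod0 : cmod (0 : R[i]) = 0.
Proof. exact: ComplexField.Normc.normc0. Qed.

Lemma ReM z w : complex.Re (z * w) =
  complex.Re z * complex.Re w - complex.Im z * complex.Im w.
Proof. by case: z; case: w. Qed.

Lemma ImM z w : complex.Im (z * w) =
  complex.Re z * complex.Im w + complex.Im z * complex.Re w.
Proof. by case: z; case: w. Qed.

Lemma ReD z w : complex.Re (z + w) = complex.Re z + complex.Re w.
Proof. by case: z; case: w. Qed.

Lemma ImD z w : complex.Im (z + w) = complex.Im z + complex.Im w.
Proof. by case: z; case: w. Qed.

Lemma Re_conj z : complex.Re (z^*)%C = complex.Re z.
Proof. by case: z. Qed.

Lemma Im_conj z : complex.Im (z^*)%C = - complex.Im z.
Proof. by case: z. Qed.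

Definition cis t : R[i] := (cos t +i* sin t)%C.

Lemma cisD s t : cis (s + t) = cis s * cis t.
Proof.
apply/eqP; rewrite eq_complex ReM ImM/= cosD sinD eqxx/=.
by rewrite addrC eqxx.
Qed.

Lemma cmod_cis t : cmod (cis t) = 1.
Proof. by rewrite cmodE/= cos2Dsin2 sqrtr1. Qed.

Lemma conjM z w : ((z * w)^*)%C = (z^*)%C * (w^*)%C.
Proof. exact: rmorphM. Qed.

Lemma conj_cis t : ((cis t)^*)%C = cis (- t).
Proof. by rewrite /cis/= cosN sinN. Qed.

End ComplexModulus.

Section ComplexMeasurable.
Context d (T : measurableType d) (R : realType).
Implicit Types (f g : T -> R[i]) (h : T -> R).

Definition cmeasurable f :=
  measurable_fun setT (fun x => complex.Re (f x)) /\
  measurable_fun setT (fun x => complex.Im (f x)).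

Lemma cmeasurableM f g : cmeasurable f -> cmeasurable g ->
  cmeasurable (fun x => f x * g x).
Proof.
move=> [mf1 mf2] [mg1 mg2]; split.
  by under eq_fun do rewrite ReM; apply: measurable_funB; exact: measurable_funM.
by under eq_fun do rewrite ImM; apply: measurable_funD; exact: measurable_funM.
Qed.

Lemma cmeasurableD f g : cmeasurable f -> cmeasurable g ->
  cmeasurable (fun x => f x + g x).
Proof.
move=> [mf1 mf2] [mg1 mg2]; split.
  by under eq_fun do rewrite ReD; exact: measurable_funD.
by under eq_fun do rewrite ImD; exact: measurable_funD.
Qed.

Lemma cmeasurable_conj f : cmeasurable f -> cmeasurable (fun x => (f x)^*)%C.
Proof.
move=> [mf1 mf2]; split; first by under eq_fun do rewrite Re_conj.
by under eq_fun do rewrite Im_conj; exact: measurableT_comp.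
Qed.

Lemma cmeasurable_real h : measurable_fun setT h ->
  cmeasurable (fun x => (h x)%:C)%C.
Proof. by move=> mh; split => //=; exact: measurable_cst. Qed.

Lemma cmeasurable_cst (z : R[i]) : cmeasurable (fun=> z).
Proof. by split; exact: measurable_cst. Qed.

Lemma cmeasurable_cis h : measurable_fun setT h ->
  cmeasurable (fun x => cis (h x)).
Proof.
move=> mh; split=> /=.
  by apply: measurableT_comp mh; apply: continuous_measurable_fun; exact: continuous_cos.
by apply: measurableT_comp mh; apply: continuous_measurable_fun; exact: continuous_sin.
Qed.

Lemma measurable_cmod f : cmeasurable f ->
  measurable_fun setT (fun x => cmod (f x)).
Proof.
move=> [mf1 mf2]; under eq_fun do rewrite cmodE.
apply: (@measurableT_comp _ _ _ _ _ _ (@Num.sqrt R)).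
  by apply: continuous_measurable_fun; exact: sqrt_continuous.
by apply: measurable_funD; exact: measurable_funX.
Qed.

End ComplexMeasurable.

Lemma cmeasurable_comp d1 d2 (T1 : measurableType d1) (T2 : measurableType d2)
    (R : realType) (f : T2 -> R[i]) (h : T1 -> T2) :
  cmeasurable f -> measurable_fun setT h -> cmeasurable (fun x => f (h x)).
Proof.
move=> [mf1 mf2] mh; split.
  exact: (measurableT_comp mf1).
exact: (measurableT_comp mf2).
Qed.

Section ComplexIntegral.
Context d (T : measurableType d) (R : realType).
Variable mu : {measure set T -> \bar R}.
Implicit Types (f g : T -> R[i]) (h : T -> R).

Definition cint f : R[i] :=
  ((\int[mu]_x complex.Re (f x)) +i* (\int[mu]_x complex.Im (f x)))%C.

Definition cintegrable f :=
  cmeasurable f /\ mu.-integrable setT (fun x => (cmod (f x))%:E).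

Lemma le_cintegrable f h : cmeasurable f ->
  mu.-integrable setT (fun x => (h x)%:E) ->
  (forall x, cmod (f x) <= h x) -> cintegrable f.
Proof.
move=> mf ih fh; split=> //; apply: le_integrable ih => //.
  by apply/measurable_EFinP; exact: measurable_cmod.
move=> x _; rewrite !abse_EFin lee_fin ger0_norm ?cmod_ge0//.
by rewrite (le_trans (fh x))// ler_norm.
Qed.

Lemma cintegrableP f : cintegrable f <->
  mu.-integrable setT (fun x => (complex.Re (f x))%:E) /\
  mu.-integrable setT (fun x => (complex.Im (f x))%:E).
Proof.
split=> [[[mf1 mf2] fi]|[i1 i2]].
  split; apply: le_integrable fi => //; try exact/measurable_EFinP;
    move=> x _; rewrite !abse_EFin lee_fin [leRHS]ger0_norm ?cmod_ge0//.
    exact: normr_Re_le.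
  exact: normr_Im_le.
have mf : cmeasurable f.
  by split; apply/measurable_EFinP; [exact: measurable_int i1|exact: measurable_int i2].
apply: (@le_cintegrable f (fun x => `|complex.Re (f x)| + `|complex.Im (f x)|)) => //.
  under eq_fun do rewrite EFinD.
  by apply: integrableD => //; exact: (@integrable_norm _ _ _ mu setT).
by move=> x; exact: cmod_le_add.
Qed.

Lemma eq_cint f g : f =1 g -> cint f = cint g.
Proof. by move=> /funext ->. Qed.

Lemma cint_real h : cint (fun x => (h x)%:C)%C = ((\int[mu]_x h x)%:C)%C.
Proof. by rewrite /cint/= Rintegral_cst// mul0r. Qed.

Lemma cint0 : cint (fun=> 0) = 0.
Proof. by rewrite /cint/= !Rintegral_cst// !mul0r. Qed.

Lemma cintD f g : cintegrable f -> cintegrable g ->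
  cint (fun x => f x + g x) = cint f + cint g.
Proof.
move=> /cintegrableP[f1 f2] /cintegrableP[g1 g2].
apply/eqP; rewrite eq_complex ReD ImD /=; apply/andP; split; apply/eqP.
  by under eq_Rintegral do rewrite ReD; exact: RintegralD.
by under eq_Rintegral do rewrite ImD; exact: RintegralD.
Qed.

Lemma cintegrableZ z f : cintegrable f -> cintegrable (fun x => z * f x).
Proof.
move=> [mf fi].
apply: (@le_cintegrable _ (fun x => cmod z * cmod (f x))).
- by apply: cmeasurableM => //; exact: cmeasurable_cst.
- under eq_fun do rewrite EFinM.
  exact: integrableZl.
- by move=> x; rewrite cmodM.
Qed.

Lemma cintZ z f : cintegrable f -> cint (fun x => z * f x) = z * cint f.
Proof.
move=> /cintegrableP[f1 f2].
have Z c h : mu.-integrable setT (fun x => (h x)%:E) ->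
    mu.-integrable setT (EFin \o (fun x => c * h x)).
  by move=> ih; rewrite /comp; under eq_fun do rewrite EFinM; exact: integrableZl.
apply/eqP; rewrite eq_complex ReM ImM /=; apply/andP; split; apply/eqP.
  under eq_Rintegral do rewrite ReM.
  by rewrite RintegralB ?RintegralZl//; exact: Z.
under eq_Rintegral do rewrite ImM.
by rewrite RintegralD ?RintegralZl//; exact: Z.
Qed.

Lemma cintegrable_conj f : cintegrable f -> cintegrable (fun x => (f x)^*)%C.
Proof.
move=> [mf fi]; apply: (@le_cintegrable _ (fun x => cmod (f x))) => //.
  exact: cmeasurable_conj.
by move=> x; rewrite cmod_conj.
Qed.

Lemma cint_conj f : cintegrable f -> cint (fun x => (f x)^*)%C = ((cint f)^*)%C.
Proof.
move=> /cintegrableP[f1 f2].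
rewrite /cint; under eq_Rintegral do rewrite Re_conj.
under [in X in (_ +i* X)%C]eq_Rintegral do rewrite Im_conj -mulN1r.
by rewrite RintegralZl// mulN1r.
Qed.

(** Rotating the integrand so that its integral becomes the nonnegative real
    number [cmod (cint f) ^+ 2] reduces the triangle inequality to the
    monotonicity of the integral of real parts. *)
Lemma cmod_cint_le f : cintegrable f -> cmod (cint f) <= \int[mu]_x cmod (f x).
Proof.
move=> fi; have [mf fi1] := fi.
set I := cint f.
have [I0|I0] := eqVneq (cmod I) 0.
  by rewrite I0; apply: Rintegral_ge0 => x _; exact: cmod_ge0.
have Ip : 0 < cmod I by rewrite lt_neqAle eq_sym I0 cmod_ge0.
rewrite -(ler_pM2l Ip) -RintegralZl//.
have -> : cmod I * cmod I = complex.Re (cint (fun x => (I^*)%C * f x)).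
  by rewrite cintZ// ReM Re_conj Im_conj -expr2 sqr_cmod -/I; ring.
have /cintegrableP[fi2 _] := cintegrableZ (I^*)%C fi.
apply: le_Rintegral => //.
- by rewrite /comp; under eq_fun do rewrite EFinM; exact: integrableZl.
- move=> x _; rewrite (le_trans (ler_norm _))// (le_trans (normr_Re_le _))//.
  by rewrite cmodM cmod_conj.
Qed.

Lemma cmod_cint_le_bound f h : cmeasurable f ->
  mu.-integrable setT (fun x => (h x)%:E) ->
  (forall x, cmod (f x) <= h x) -> cmod (cint f) <= \int[mu]_x h x.
Proof.
move=> mf ih fh; have fi := le_cintegrable mf ih fh.
rewrite (le_trans (cmod_cint_le fi))// le_Rintegral//.
by case: fi.
Qed.

Lemma ae_eq_cint f g : cmeasurable f -> cmeasurable g ->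
  {ae mu, forall x, f x = g x} -> cint f = cint g.
Proof.
move=> [mf1 mf2] [mg1 mg2] fg; rewrite /cint; congr (_ +i* _)%C; congr fine;
  apply: ae_eq_integral => //; try exact/measurable_EFinP;
  by apply: filterS fg => x /= -> _.
Qed.

End ComplexIntegral.

(** * Iterated integrals and dominated convergence *)

Section SigmaFiniteProduct.
Context d1 d2 (T1 : measurableType d1) (T2 : measurableType d2) (R : realType).
Variables (m1 : {sigma_finite_measure set T1 -> \bar R})
          (m2 : {sigma_finite_measure set T2 -> \bar R}).

(** The product measure under a name of its own, so that its sigma-finiteness is
    inferred and products can be iterated. *)
Definition sprod : set (T1 * T2) -> \bar R := (m1 \x m2)%E.

HB.instance Definition _ := Measure.on sprod.

Lemma sigma_finite_sprod : sigma_finite setT sprod.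
Proof.
exact: (isSigmaFinite.sigma_finiteT
  (lebesgue_integral_fubini.measure_function_Measure_isSigmaFinite__to__measure_function_isSigmaFinite
    m1 m2)).
Qed.

HB.instance Definition _ :=
  Measure_isSigmaFinite.Build _ _ _ sprod sigma_finite_sprod.

Lemma ge0_integral_sprodM (a : T1 -> R) (b : T2 -> R) :
  measurable_fun setT a -> measurable_fun setT b ->
  (forall x, 0 <= a x) -> (forall y, 0 <= b y) ->
  (\int[sprod]_z (a z.1 * b z.2)%:E =
   \int[m1]_x (a x)%:E * \int[m2]_y (b y)%:E)%E.
Proof.
move=> ma mb a0 b0.
rewrite (fubini_tonelli1 (fun z : T1 * T2 => (a z.1 * b z.2)%:E)); first last.
- by move=> z; rewrite lee_fin mulr_ge0.
- apply/measurable_EFinP/measurable_funM.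
  + exact: (measurableT_comp ma).
  + exact: (measurableT_comp mb).
rewrite -ge0_integralZr//; first last.
- by apply: integral_ge0 => y _; rewrite lee_fin.
- by move=> x _; rewrite lee_fin.
- exact/measurable_EFinP.
apply: eq_integral => x _; rewrite /fubini_F/=.
under eq_integral do rewrite EFinM.
rewrite ge0_integralZl//.
- exact/measurable_EFinP.
- by move=> y _; rewrite lee_fin.
- by rewrite lee_fin.
Qed.

Lemma integrable_sprodM (a : T1 -> R) (b : T2 -> R) :
  m1.-integrable setT (fun x => (a x)%:E) ->
  m2.-integrable setT (fun y => (b y)%:E) ->
  sprod.-integrable setT (fun z => (a z.1 * b z.2)%:E).
Proof.
move=> /integrableP[/measurable_EFinP ma ia] /integrableP[/measurable_EFinP mb ib].
apply/integrableP; split.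
  apply/measurable_EFinP/measurable_funM.
    exact: (measurableT_comp ma).
  exact: (measurableT_comp mb).
under eq_integral do rewrite abse_EFin normrM.
rewrite (ge0_integral_sprodM (a := fun x => `|a x|) (b := fun y => `|b y|))//.
- apply: lte_mul_pinfty => //; first by apply: integral_ge0 => x _; rewrite lee_fin.
  by rewrite ge0_fin_numE //; apply: integral_ge0 => x _; rewrite lee_fin.
- exact: measurableT_comp.
- exact: measurableT_comp.
Qed.

Lemma Rintegral_sprod12 (h : T1 * T2 -> R) :
  sprod.-integrable setT (fun z => (h z)%:E) ->
  \int[m1]_x (\int[m2]_y h (x, y)) = \int[sprod]_z h z.
Proof.
move=> ih; congr fine; rewrite -(integral12_prod_meas1 ih).
have mF := measurable_fubini_F ih.
apply: ae_eq_integral => //.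
  apply/measurable_EFinP; apply: (measurableT_comp _ mF).
  exact: fine_measurable.
apply: filterS (ae_integrable1 ih) => x ix _.
by rewrite fineK// integrable_fin_num.
Qed.

Lemma Rintegral_sprod21 (h : T1 * T2 -> R) :
  sprod.-integrable setT (fun z => (h z)%:E) ->
  \int[m2]_y (\int[m1]_x h (x, y)) = \int[sprod]_z h z.
Proof.
move=> ih; congr fine; rewrite -(integral21_prod_meas1 ih).
have mG := measurable_fubini_G ih.
apply: ae_eq_integral => //.
  apply/measurable_EFinP; apply: (measurableT_comp _ mG).
  exact: fine_measurable.
apply: filterS (ae_integrable2 ih) => x ix _.
by rewrite fineK// integrable_fin_num.
Qed.

Lemma measurable_Rintegral_section (h : T1 * T2 -> R) :
  measurable_fun setT h -> measurable_fun setT (fun x => \int[m2]_y h (x, y)).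
Proof.
move=> mh; have meh : measurable_fun setT (EFin \o h) by exact/measurable_EFinP.
have -> : (fun x => \int[m2]_y h (x, y)) = fine \o
    ((fubini_F m2 (EFin \o h)^\+) \- (fubini_F m2 (EFin \o h)^\-))%E.
  apply/funext => x /=; congr fine; rewrite integralE; congr (_ - _)%E.
    by apply: eq_integral => y _; rewrite !funeposE.
  by apply: eq_integral => y _; rewrite !funenegE.
apply: (measurableT_comp (fine_measurable measurableT)).
apply: emeasurable_funB; apply: measurable_fun_fubini_tonelli_F => //.
  exact: measurable_funepos.
exact: measurable_funeneg.
Qed.

Lemma cint_sprod12 (f : T1 * T2 -> R[i]) : cintegrable sprod f ->
  cint m1 (fun x => cint m2 (fun y => f (x, y))) = cint sprod f.
Proof.
move=> /cintegrableP[f1 f2]; rewrite /cint /=; congr (_ +i* _)%C.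
  exact: (Rintegral_sprod12 (h := fun z => complex.Re (f z))).
exact: (Rintegral_sprod12 (h := fun z => complex.Im (f z))).
Qed.

Lemma cint_sprod21 (f : T1 * T2 -> R[i]) : cintegrable sprod f ->
  cint m2 (fun y => cint m1 (fun x => f (x, y))) = cint sprod f.
Proof.
move=> /cintegrableP[f1 f2]; rewrite /cint /=; congr (_ +i* _)%C.
  exact: (Rintegral_sprod21 (h := fun z => complex.Re (f z))).
exact: (Rintegral_sprod21 (h := fun z => complex.Im (f z))).
Qed.

Lemma cint_Fubini (f : T1 * T2 -> R[i]) : cintegrable sprod f ->
  cint m1 (fun x => cint m2 (fun y => f (x, y))) =
  cint m2 (fun y => cint m1 (fun x => f (x, y))).
Proof. by move=> fi; rewrite cint_sprod12// cint_sprod21. Qed.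

Lemma cmeasurable_cint_section (f : T1 * T2 -> R[i]) :
  cmeasurable f -> cmeasurable (fun x => cint m2 (fun y => f (x, y))).
Proof.
move=> [mf1 mf2]; split => /=.
  exact: (measurable_Rintegral_section (h := fun z => complex.Re (f z))).
exact: (measurable_Rintegral_section (h := fun z => complex.Im (f z))).
Qed.

Lemma cintegrable_sprodM (f : T1 -> R[i]) (g : T2 -> R[i]) :
  cintegrable m1 f -> cintegrable m2 g ->
  cintegrable sprod (fun z => f z.1 * g z.2).
Proof.
move=> [mf fi] [mg gi].
apply: (@le_cintegrable _ _ _ _ _ (fun z => cmod (f z.1) * cmod (g z.2))).
- apply: cmeasurableM.
    exact: (cmeasurable_comp mf).
  exact: (cmeasurable_comp mg).
- exact: (integrable_sprodM (a := fun x => cmod (f x)) (b := fun y => cmod (g y))).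
- by move=> z; rewrite cmodM.
Qed.

Lemma cint_sprodM (f : T1 -> R[i]) (g : T2 -> R[i]) :
  cintegrable m1 f -> cintegrable m2 g ->
  cint sprod (fun z => f z.1 * g z.2) = cint m1 f * cint m2 g.
Proof.
move=> fi gi; rewrite -cint_sprod12/=; last exact: cintegrable_sprodM.
rewrite mulrC -cintZ//; apply: eq_cint => x.
by rewrite cintZ// mulrC.
Qed.

End SigmaFiniteProduct.

Section LimitTheorems.
Context d (T : measurableType d) (R : realType).
Variable mu : {measure set T -> \bar R}.
Implicit Types (f g : T -> R[i]).

(** Convergence of the multipliers is asked only where [f] does not vanish: the
    spectral cutoffs used below do not tend to 1 at the origin, where the symbol
    is 0. *)
Lemma cint_dominated_cvg f (phi : nat -> T -> R) : cintegrable mu f ->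
  (forall n, measurable_fun setT (phi n)) ->
  (forall n x, `|phi n x| <= 1) ->
  (forall x, f x != 0 -> phi n x @[n --> \oo] --> (1 : R)) ->
  cmod (cint mu (fun x => (phi n x)%:C%C * f x) - cint mu f) @[n --> \oo]
    --> (0 : R).
Proof.
move=> fi mphi phi1 phicvg; have [mf fi1] := fi.
have mc := measurable_cmod mf.
have phif n : cintegrable mu (fun x => (phi n x)%:C%C * f x).
  apply: (@le_cintegrable _ _ _ _ _ (fun x => cmod (f x))) => //.
    by apply: cmeasurableM => //; exact: cmeasurable_real.
  by move=> x; rewrite cmodM cmod_real ler_piMl ?cmod_ge0.
pose h n x := `|phi n x - 1| * cmod (f x).
have mh n : measurable_fun setT (h n).
  by apply: measurable_funM => //; apply: measurableT_comp => //; exact: measurable_funB.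
have h_le n x : `|h n x| <= 2 * cmod (f x).
  rewrite ger0_norm ?mulr_ge0 ?cmod_ge0// ler_wpM2r ?cmod_ge0//.
  by rewrite (le_trans (ler_normB _ _))// normr1 (_ : 2 = 1 + 1)// lerD.
have i2 : mu.-integrable setT (fun x => (2 * cmod (f x))%:E).
  by under eq_fun do rewrite EFinM; exact: integrableZl.
have ih n : mu.-integrable setT (fun x => (h n x)%:E).
  apply: le_integrable i2 => //; first exact/measurable_EFinP.
  move=> x _; rewrite !abse_EFin lee_fin (le_trans (h_le n x))//.
  exact: ler_norm.
have cvgh : (\int[mu]_x (h n x)%:E)%E @[n --> \oo] --> 0%E.
  rewrite -(integral0 mu setT).
  apply: (@dominated_cvg _ _ _ mu setT measurableT (fun n x => (h n x)%:E) (cst 0%E)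
    (fun x => (2 * cmod (f x))%:E)) => //.
  - by move=> n; exact/measurable_EFinP.
  - move=> x _ /=; apply: cvg_EFin; first by exact: nearW.
    have [fx0|fx0] := eqVneq (f x) 0.
      rewrite [X in X @ _ --> _](_ : _ = cst 0) ?cvg_cst//; first exact: cvg_cst.
      by apply/funext => n /=; rewrite /h fx0 cmod0 mulr0.
    rewrite -[0](mul0r (cmod (f x))); apply: cvgMl => /=.
    rewrite -[0](normr0 R) -(subrr 1); apply: cvg_norm.
    by apply: cvgB; [exact: phicvg|exact: cvg_cst].
  - by move=> n x _; rewrite abse_EFin lee_fin.
have cvgR : (\int[mu]_x h n x) @[n --> \oo] --> (0 : R).
  by apply: fine_cvg; exact: cvgh.
apply: (@squeeze_cvgr _ _ _ _ (cst 0) (fun n => \int[mu]_x h n x)) => //.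
- apply: nearW => n; apply/andP; split; first exact: cmod_ge0.
  rewrite -(mulN1r (cint mu f)) -cintZ// -cintD//.
    apply: cmod_cint_le_bound => //; last first.
      move=> x; rewrite -mulrDl cmodM /h.
      by rewrite -(rmorph1 (real_complex R)) -rmorphB cmod_real.
    apply: cmeasurableD; first by case: (phif n).
    by case: (cintegrableZ (-1) fi).
  exact: cintegrableZ.
- exact: cvg_cst.
Qed.

End LimitTheorems.

(** * Limits of complex sequences and square-integrable functions *)

Section ComplexLimits.
Variable R : realType.
Implicit Types (z : nat -> R[i]) (L : R[i]).

Lemma cmod_cvg_le z L (K : R) : cmod (z n - L) @[n --> \oo] --> (0 : R) ->
  (forall n, cmod (z n) <= K) -> cmod L <= K.
Proof.
move=> zL zK; apply/ler_addgt0Pr => e e0.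
have /cvgrPdist_le /(_ e e0) [N _ /(_ N (leqnn N))/=] := zL.
rewrite sub0r normrN (ger0_norm (cmod_ge0 _)) => zN.
have {1}-> : L = z N - (z N - L) by rewrite opprB addrC subrK.
by rewrite (le_trans (cmodD _ _))// cmodN lerD.
Qed.

Lemma cmod_cvg_unique z L1 L2 : cmod (z n - L1) @[n --> \oo] --> (0 : R) ->
  cmod (z n - L2) @[n --> \oo] --> (0 : R) -> L1 = L2.
Proof.
move=> z1 z2; apply/eqP; rewrite -subr_eq0; apply/eqP.
apply: ComplexField.Normc.eq0_normc; apply/eqP.
rewrite eq_le cmod_ge0 andbT; apply/ler_addgt0Pr => e e0; rewrite add0r.
have e2 : 0 < e / 2 by rewrite divr_gt0.
have /cvgrPdist_le/(_ _ e2) n1 := z1; have /cvgrPdist_le/(_ _ e2) n2 := z2.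
have [N _ /(_ N (leqnn N))/=] := filterI n1 n2.
rewrite !sub0r !normrN !(ger0_norm (cmod_ge0 _)) => -[zN1 zN2].
have -> : L1 - L2 = (z N - L2) - (z N - L1).
  by rewrite opprB [RHS]addrC addrA subrK.
by rewrite (le_trans (cmodD _ _))// cmodN (splitr e) lerD.
Qed.

End ComplexLimits.

Section SquareIntegrable.
Context d (T : measurableType d) (R : realType).
Variable mu : {measure set T -> \bar R}.
Implicit Types (f g w : T -> R[i]).

Definition L2norm f : \bar R := Lnorm mu 2%:E (fun x => (cmod (f x))%:E).

Definition csquare_integrable f := cmeasurable f /\ (L2norm f < +oo)%E.

Lemma L2norm_lty f : (L2norm f < +oo)%E <->
  (\int[mu]_x (cmod (f x) ^+ 2)%:E < +oo)%E.
Proof.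
have E : (\int[mu]_x (cmod (f x) ^+ 2)%:E = \int[mu]_x (`|(cmod (f x))%:E| `^ 2))%E.
  apply: eq_integral => x _; rewrite abse_EFin ger0_norm ?cmod_ge0// poweR_EFin.
  by rewrite powR_mulrn ?cmod_ge0.
rewrite E; split=> [|h].
  by rewrite -poweR_Lnorm// => h; exact: poweR_lty.
by rewrite /L2norm unlock; exact: poweR_lty.
Qed.

Lemma le_csquare_integrable f g : cmeasurable f ->
  (forall x, cmod (f x) <= cmod (g x)) -> csquare_integrable g ->
  csquare_integrable f.
Proof.
move=> mf fg [mg /L2norm_lty gi]; split=> //; apply/L2norm_lty.
apply: le_lt_trans gi; apply: ge0_le_integral => //.
- by move=> x _; rewrite lee_fin sqr_ge0.
- by apply/measurable_EFinP/measurable_funX; exact: measurable_cmod.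
- by apply/measurable_EFinP/measurable_funX; exact: measurable_cmod.
- by move=> x _; rewrite lee_fin lerXn2r ?nnegrE ?cmod_ge0.
Qed.

Lemma csquare_integrableM f g :
  csquare_integrable f -> csquare_integrable g ->
  cintegrable mu (fun x => f x * g x) /\
  ((cmod (cint mu (fun x => f x * g x)))%:E <= L2norm f * L2norm g)%E.
Proof.
move=> [mf fi] [mg gi].
have mcf := measurable_cmod mf; have mcg := measurable_cmod mg.
have H : (\int[mu]_x `|(cmod (f x) * cmod (g x))%:E| <= L2norm f * L2norm g)%E.
  have := @hoelder _ _ _ mu (fun x => cmod (f x)) (fun x => cmod (g x)) 2 2 mcf mcg.
  rewrite Lnorm1; apply => //.
  by rewrite [RHS](splitr 1) !div1r.
have fgi : cintegrable mu (fun x => f x * g x).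
  split; first exact: cmeasurableM.
  apply/integrableP; split.
    by apply/measurable_EFinP/measurable_cmod; exact: cmeasurableM.
  under eq_integral do rewrite cmodM.
  apply: (le_lt_trans H); apply: lte_mul_pinfty => //; first exact: Lnorm_ge0.
  by rewrite ge0_fin_numE//; exact: Lnorm_ge0.
split=> //; apply: le_trans H.
have [_ ifg] := fgi.
rewrite (le_trans (y := (\int[mu]_x cmod (f x * g x))%:E))//.
  by rewrite lee_fin; exact: cmod_cint_le.
rewrite /Rintegral fineK; last exact: integrable_fin_num.
rewrite le_eqVlt; apply/orP; left; apply/eqP; apply: eq_integral => x _.
by rewrite abse_EFin cmodM ger0_norm// mulr_ge0 ?cmod_ge0.
Qed.

(** Only the differences [f - fn n] are known to have finite norm, and only from
    some rank on; so the integral of [fn n * w] is reached from that of [f * w] by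
    adding the pairing of a difference with [w], which Hoelder's inequality
    controls. *)
Lemma cvg_cint_L2 f (fn : nat -> T -> R[i]) w : csquare_integrable f ->
  (forall n, cmeasurable (fn n)) -> csquare_integrable w ->
  L2norm (fun x => f x - fn n x) @[n --> \oo] --> 0%E ->
  cmod (cint mu (fun x => fn n x * w x) - cint mu (fun x => f x * w x))
    @[n --> \oo] --> (0 : R).
Proof.
move=> fi mfn wi fnf; have [mf fi2] := fi; have [mw wi2] := wi.
have [ifw _] := csquare_integrableM fi wi.
have /fine_cvgP[fin fnf'] : L2norm (fun x => f x - fn n x) @[n --> \oo] --> (0 : R)%:E.
  exact: fnf.
apply: (@squeeze_cvgr _ _ _ _ (cst 0)
    (fun n => fine (L2norm (fun x => f x - fn n x)) * fine (L2norm w))).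
- near=> n; apply/andP; split; first exact: cmod_ge0.
  have Dfin : (L2norm (fun x => f x - fn n x)%R < +oo)%E.
    by rewrite -ge0_fin_numE ?Lnorm_ge0//; near: n.
  have mD : cmeasurable (fun x => f x - fn n x).
    apply: cmeasurableD => //.
    have := cmeasurableM (cmeasurable_cst T (-1)) (mfn n).
    by under eq_fun do rewrite mulN1r.
  have [iD bD] := csquare_integrableM (conj mD Dfin) wi.
  have -> : cint mu (fun x => fn n x * w x) =
      cint mu (fun x => f x * w x) + cint mu (fun x => -1 * ((f x - fn n x) * w x)).
    rewrite -cintD//; last exact: cintegrableZ.
    by apply: eq_cint => x; ring.
  rewrite addrAC subrr add0r cintZ// cmodM cmodN.
  rewrite (_ : cmod 1 = 1) ?mul1r; last exact: ComplexField.Normc.normc1.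
  rewrite -lee_fin EFinM !fineK ?ge0_fin_numE//; exact: Lnorm_ge0.
- exact: cvg_cst.
- rewrite -[0](mul0r (fine (L2norm w))); exact: cvgMl.
Unshelve. all: by end_near. Qed.

End SquareIntegrable.

(** * Integrals over the real line *)

Section RealLineCalculus.
Variable R : realType.
Local Notation mu := (@lebesgue_measure R).
Implicit Types (h H : R -> R).

Lemma is_derive_continuous H h : (forall x : R, is_derive x (1 : R) H (h x)) -> continuous H.
Proof.
move=> dH x; apply: differentiable_continuous; apply/derivable1_diffP.
exact: ex_derive.
Qed.

Lemma integral_itv_FTC H h (a b : R) : a <= b ->
  (forall x : R, is_derive x (1 : R) H (h x)) -> continuous h ->
  (\int[mu]_(x in `[a, b]) (h x)%:E = (H b - H a)%:E)%E.
Proof.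
move=> ab dH ch; have cH := is_derive_continuous dH.
move: ab; rewrite le_eqVlt => /predU1P[->|ab].
  by rewrite set_itv1 integral_set1 subrr.
rewrite (@continuous_FTC2 _ h H)//.
- exact: continuous_subspaceT.
- split.
  + by move=> x _; exact: ex_derive.
  + by apply: cvg_at_right_filter; exact: cH.
  + by apply: cvg_at_left_filter; exact: cH.
- by move=> x _; rewrite derive1E; exact: derive_val.
Qed.

Lemma bigcup_itvNn : \bigcup_n `[(- n%:R)%R, n%:R]%classic = [set: R].
Proof.
apply/seteqP; split => // x _.
exists (Num.Def.trunc `|x|).+1 => //=; rewrite in_itv/= -ler_norml.
exact/ltW/truncnS_gt.
Qed.

Lemma nondecreasing_itvNn :
  nondecreasing_seq (fun n => `[(- n%:R)%R, n%:R]%classic : set R).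
Proof.
move=> m n mn; apply/subsetPset => x /=; rewrite !in_itv/= => /andP[mx xm].
have mn' : m%:R <= n%:R :> R by rewrite ler_nat.
by rewrite (le_trans _ mx) ?(le_trans xm)// lerN2.
Qed.

Lemma cvg_integral_itvNn h : mu.-integrable setT (EFin \o h) ->
  (\int[mu]_(x in `[(- n%:R)%R, n%:R]) (h x)%:E)%E @[n --> \oo]
  --> (\int[mu]_x (h x)%:E)%E.
Proof.
move=> ih; have mh : measurable_fun setT (EFin \o h) by exact: measurable_int ih.
under eq_fun do rewrite integral_mkcond.
apply: (@dominated_cvg _ _ _ mu setT measurableT _ _ (fun x => `|h x|%:E)) => //.
- by move=> n; apply/(measurable_restrictT (EFin \o h)) => //; exact: measurable_funS mh.
- move=> x _.
  have : (\bigcup_n `[(- n%:R)%R, n%:R]%classic) x by rewrite bigcup_itvNn.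
  move=> [N _ xN]; apply: cvg_near_cst; exists N => // n /= Nn.
  rewrite patchE mem_set//; move: x xN; apply/subsetPset.
  exact: nondecreasing_itvNn.
- exact: integrable_norm.
- move=> n x _; rewrite patchE; case: ifPn => _; first by rewrite abse_EFin.
  by rewrite abse0 lee_fin.
Qed.

(** The boundary terms of the fundamental theorem of calculus on [[-n, n]]
    vanish in the limit. *)
Lemma integral_derive_eq0 H h : (forall x : R, is_derive x (1 : R) H (h x)) ->
  continuous h -> mu.-integrable setT (EFin \o h) ->
  H n%:R @[n --> \oo] --> (0 : R) -> H (- n%:R) @[n --> \oo] --> (0 : R) ->
  \int[mu]_x h x = 0.
Proof.
move=> dH ch ih Hy HNy; have := cvg_integral_itvNn ih.
have -> : (fun n => \int[mu]_(x in `[(- n%:R)%R, n%:R]) (h x)%:E)%E =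
    (fun n => (H n%:R - H (- n%:R))%:E).
  apply/funext => n; rewrite (integral_itv_FTC _ dH)//.
  by rewrite -subr_ge0 opprK addr_ge0.
have : (H n%:R - H (- n%:R))%:E @[n --> \oo] --> (0 : R)%:E.
  apply: cvg_EFin; first exact: nearW.
  by rewrite -[0](subrr 0); exact: cvgB.
move=> c0 c1; rewrite /Rintegral -(cvg_lim _ c1)//.
by rewrite (cvg_lim _ c0).
Qed.

(** A Cauchy (Lorentzian) profile, the common majorant of all the one-dimensional
    functions below: its integral is explicit and scales with [a^-1]. *)
Definition lorentz (a b x : R) : R := (1 + (a * x + b) ^+ 2)^-1.

Lemma lorentz_gt0 a b x : 0 < lorentz a b x.
Proof. by rewrite invr_gt0 ltr_pwDl// sqr_ge0. Qed.

Lemma continuous_lorentz a b : continuous (lorentz a b).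
Proof.
move=> x; apply: cvgV; first by rewrite gt_eqF// ltr_pwDl// sqr_ge0.
apply: cvgD; first exact: cvg_cst.
apply: (@cvg_comp _ _ _ (fun x => a * x + b) (fun x => x ^+ 2)); last exact: exprn_continuous.
apply: cvgD; last exact: cvg_cst.
exact: mulrl_continuous.
Qed.

Lemma measurable_lorentz a b : measurable_fun setT (lorentz a b).
Proof. by apply: continuous_measurable_fun; exact: continuous_lorentz. Qed.

Lemma is_derive_atan_affine (a b x : R) : a != 0 ->
  is_derive x 1 (fun x => atan (a * x + b) / a) (lorentz a b x).
Proof.
move=> a0.
have d1 : is_derive x 1 (fun x => a * x + b) a.
  have -> : (fun x => a * x + b) = (a \*: id) + cst b by apply/funext.
  by apply: is_derive_eq; rewrite addr0 /GRing.scale/= mulr1.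
have d2 := @is_derive1_comp R atan (fun x => a * x + b) x _ _ (is_derive1_atan _) d1.
have -> : (fun x => atan (a * x + b) / a) = (a^-1 \*: (atan \o (fun x => a * x + b))).
  by apply/funext => y /=; rewrite mulrC.
have d3 := @is_deriveZ _ _ _ _ a^-1 x 1 _ d2.
apply: is_derive_eq.
by rewrite /lorentz /GRing.scale/= mulrCA mulVf ?mulr1.
Qed.

Lemma integral_lorentz_le (a b : R) : 0 < a ->
  (\int[mu]_x (lorentz a b x)%:E <= (pi / a)%:E)%E.
Proof.
move=> a0.
have cv : (\int[mu]_(x in `[(- n%:R)%R, n%:R]) (lorentz a b x)%:E)%E @[n --> \oo]
    --> (\int[mu]_x (lorentz a b x)%:E)%E.
  rewrite -bigcup_itvNn.
  apply: (@ge0_nondecreasing_set_cvg_integral _ (measurableTypeR R)).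
  - exact: nondecreasing_itvNn.
  - by move=> n; exact: measurable_itv.
  - by move=> n; apply/measurable_EFinP/measurable_funTS; exact: measurable_lorentz.
  - by move=> n x _; rewrite lee_fin ltW// lorentz_gt0.
have <- := cvg_lim _ cv => //.
apply: lime_le; first by apply/cvg_ex; eexists; exact: cv.
apply: nearW => n.
have dF (x : R) := is_derive_atan_affine b x (lt0r_neq0 a0).
rewrite (integral_itv_FTC _ dF); first last.
- exact: continuous_lorentz.
- by rewrite -subr_ge0 opprK addr_ge0.
rewrite lee_fin -mulrBl ler_pM2r ?invr_gt0//.
have := ltW (atan_ltpi2 (a * n%:R + b)).
have := ltW (atan_gtNpi2 (a * (- n%:R) + b)).
by move: (atan _) (atan _) => u v; lra.
Qed.

Lemma integrable_lorentz (a b : R) : 0 < a ->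
  mu.-integrable setT (EFin \o lorentz a b).
Proof.
move=> a0; apply/integrableP; split.
  by apply/measurable_EFinP; exact: measurable_lorentz.
under eq_integral do rewrite abse_EFin (ger0_norm (ltW (lorentz_gt0 _ _ _))).
by rewrite (le_lt_trans (integral_lorentz_le b a0))// ltry.
Qed.

Lemma Rintegral_lorentz_le (a b : R) : 0 < a ->
  \int[mu]_x lorentz a b x <= pi / a.
Proof.
move=> a0; rewrite -lee_fin /Rintegral fineK ?integral_lorentz_le//.
exact: (integrable_fin_num _ (integrable_lorentz b a0)).
Qed.

End RealLineCalculus.

(** * Oscillatory integrals of polynomials times a Gaussian *)

Section GaussianPolynomials.
Variable R : realType.
Local Notation mu := (@lebesgue_measure R).
Implicit Types (p : {poly R}) (s w v : R).

Definition pgauss p v : R := p.[v] * expR (- v ^+ 2).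

Definition dgauss p : {poly R} := p^`() - ('X * p) *+ 2.

Lemma is_derive_pgauss p v : is_derive v (1 : R) (pgauss p) (pgauss (dgauss p) v).
Proof.
have d1 : is_derive v 1 (fun x : R => - x ^+ 2) (- (2 * v)).
  have -> : (fun x : R => - x ^+ 2) = - (id ^+ 2) by apply/funext.
  by apply: is_derive_eq; rewrite expr1 /GRing.scale/= mulr1.
have d2 := @is_derive1_comp R expR _ v _ _ (is_derive_expR _) d1.
have d3 := @is_deriveM _ _ _ _ v 1 _ _ (is_derive_poly p v) d2.
apply: (@is_derive_eq _ _ _ _ _ _ _ _ d3).
rewrite /pgauss /dgauss /= !hornerE /GRing.scale/=; ring.
Qed.

Lemma continuous_pgauss p : continuous (pgauss p).
Proof. exact: (is_derive_continuous (is_derive_pgauss p)). Qed.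

Lemma horner_le_expr p : exists2 A, 0 <= A &
  forall v, `|p.[v]| <= A * (1 + v ^+ 2) ^+ size p.
Proof.
elim/poly_ind: p => [|p c [A A0 IH]].
  by exists 0 => // v; rewrite horner0 normr0 mul0r.
have [->|p0] := eqVneq p 0.
  exists `|c| => // v; rewrite mul0r add0r hornerC ler_peMr// exprn_ege1//.
  by rewrite lerDl sqr_ge0.
exists (A + `|c|); first by rewrite addr_ge0.
move=> v; rewrite size_MXaddC (negPf p0)/= hornerE hornerMX hornerC.
set y := 1 + v ^+ 2.
have y1 : 1 <= y by rewrite lerDl sqr_ge0.
have y0 : 0 <= y by rewrite (le_trans ler01).
have vy : `|v| <= y.
  rewrite /y -(real_normK (num_real v)); have := sqr_ge0 (`|v| - 1).
  by have := normr_ge0 v; move: `|v| => a; nra.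
rewrite (le_trans (ler_normD _ _))// mulrDl lerD//.
  by rewrite normrM exprSr mulrA ler_pM.
by rewrite ler_peMr// exprn_ege1.
Qed.

(** The factor [expR (- v ^+ 2)] beats every power of [1 + v ^+ 2], in
    particular the power that dominates [p] times [1 + v ^+ 2]. *)
Lemma pgauss_le p : exists2 A, 0 <= A &
  forall v, `|pgauss p v| <= A * (1 + v ^+ 2)^-1.
Proof.
have [A A0 pA] := horner_le_expr p.
exists (A * (expR 1 * (size p).+1`!%:R)) => [|v].
  by rewrite !mulr_ge0// expR_ge0.
set n := size p in pA *; have := pA v; set y := 1 + v ^+ 2 => pAv.
have y1 : 1 <= y by rewrite lerDl sqr_ge0.
have y0 : 0 < y by rewrite (lt_le_trans ltr01).
rewrite /pgauss normrM (ger0_norm (expR_ge0 _)) ler_pdivlMr//.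
have -> : - v ^+ 2 = 1 - y by rewrite /y; ring.
rewrite expRD expRN.
have ey : y ^+ n.+1 / n.+1`!%:R <= expR y.
  apply: le_trans (expR_ge1Dxn n (ltW y0)); rewrite lerDr//.
have f0 : 0 < n.+1`!%:R :> R by rewrite ltr0n fact_gt0.
have e0 := expR_gt0 y.
have {}ey : y ^+ n.+1 / expR y <= n.+1`!%:R.
  by rewrite ler_pdivrMr// mulrC -ler_pdivrMr.
rewrite [leLHS](_ : _ = `|p.[v]| * y * (expR 1 / expR y)); last by ring.
rewrite (le_trans (y := A * y ^+ n * y * (expR 1 / expR y)))//.
  rewrite ler_wpM2r ?divr_ge0 ?expR_ge0// ler_wpM2r// ltW//.
rewrite [leLHS](_ : _ = A * (expR 1 * (y ^+ n.+1 / expR y))); last by rewrite exprSr; ring.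
by rewrite ler_wpM2l// ler_wpM2l// expR_ge0.
Qed.

(** The Fourier transform, at frequency [w], of [pgauss p] rescaled by [s]. *)
Definition wave p s w : R[i] :=
  cint mu (fun x => (pgauss p (s * x))%:C%C * cis (w * x)).

Lemma pgauss_scale_le p A s x : (forall v, `|pgauss p v| <= A * (1 + v ^+ 2)^-1) ->
  `|pgauss p (s * x)| <= A * lorentz s 0 x.
Proof. by move=> /(_ (s * x)); rewrite /lorentz addr0. Qed.

Lemma measurable_pgauss_scale p s :
  measurable_fun setT (fun x => pgauss p (s * x)).
Proof.
apply: (measurableT_comp (f := pgauss p)).
  by apply: continuous_measurable_fun; exact: continuous_pgauss.
exact: mulrl_measurable.
Qed.

Lemma integrable_pgauss_scale p s : 0 < s ->
  mu.-integrable setT (EFin \o (fun x => pgauss p (s * x))).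
Proof.
move=> s0; have [A A0 pA] := pgauss_le p.
apply: (@le_integrable _ _ _ mu setT measurableT _ (fun x => (A * lorentz s 0 x)%:E)).
- by apply/measurable_EFinP; exact: measurable_pgauss_scale.
- move=> x _; rewrite !abse_EFin lee_fin (le_trans (pgauss_scale_le _ _ pA))//.
  exact: ler_norm.
- under eq_fun do rewrite EFinM.
  by apply: integrableZl => //; exact: integrable_lorentz.
Qed.

Lemma cmeasurable_wave p s w :
  cmeasurable (fun x => (pgauss p (s * x))%:C%C * cis (w * x)).
Proof.
apply: cmeasurableM.
  by apply: cmeasurable_real; exact: measurable_pgauss_scale.
by apply: cmeasurable_cis; exact: mulrl_measurable.
Qed.

Lemma cintegrable_wave p s w : 0 < s ->
  cintegrable mu (fun x => (pgauss p (s * x))%:C%C * cis (w * x)).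
Proof.
move=> s0.
apply: (@le_cintegrable _ (measurableTypeR R) R mu _ (fun x => `|pgauss p (s * x)|)).
- exact: cmeasurable_wave.
- exact: (integrable_norm (integrable_pgauss_scale p s0)).
- by move=> x; rewrite cmodM cmod_real cmod_cis mulr1.
Qed.

(** The factor [s^-1] comes from integrating the majorant [lorentz s 0]. *)
Lemma wave_le p : exists2 A, 0 <= A &
  forall s w, 0 < s -> cmod (wave p s w) <= A / s.
Proof.
have [A A0 pA] := pgauss_le p; exists (A * pi); first by rewrite mulr_ge0// pi_ge0.
move=> s w s0.
apply: (@le_trans _ _ (\int[mu]_x (A * lorentz s 0 x))).
  apply: (@cmod_cint_le_bound _ (measurableTypeR R)).
  - exact: cmeasurable_wave.
  - under eq_fun do rewrite EFinM.
    by apply: integrableZl => //; exact: integrable_lorentz.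
  - by move=> x; rewrite cmodM cmod_real cmod_cis mulr1; exact: pgauss_scale_le.
rewrite RintegralZl//; last exact: integrable_lorentz.
by rewrite -mulrA ler_wpM2l// Rintegral_lorentz_le.
Qed.

Lemma cvg_pgauss_scale p s (x : nat -> R) (t : R -> R) : 0 < s ->
  (forall n, x n ^+ 2 = n%:R ^+ 2) -> (forall y, `|t y| <= 1) ->
  pgauss p (s * x n) * t (x n) @[n --> \oo] --> (0 : R).
Proof.
move=> s0 xn t1; have [A A0 pA] := pgauss_le p.
pose K := A * (2 + (s ^+ 2)^-1).
have H n : `|pgauss p (s * x n) * t (x n)| <= K * harmonic n.
  rewrite normrM (le_trans (ler_piMr _ (t1 _)))// (le_trans (pA _))//.
  rewrite /K -mulrA ler_wpM2l//= /harmonic.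
  rewrite exprMn xn -div1r ler_pdivrMr; last by rewrite ltr_pwDl// mulr_ge0// sqr_ge0.
  rewrite mulrAC ler_pdivlMr ?ltr0n// mul1r -natr1.
  have -> : (2 + (s ^+ 2)^-1) * (1 + s ^+ 2 * n%:R ^+ 2) =
      2 + n%:R ^+ 2 + ((s ^+ 2)^-1 + 2 * s ^+ 2 * n%:R ^+ 2) :> R.
    by field; rewrite gt_eqF.
  have h1 : 0 <= (s ^+ 2)^-1 + 2 * s ^+ 2 * n%:R ^+ 2.
    apply: addr_ge0; first by rewrite invr_ge0 sqr_ge0.
    by apply: mulr_ge0; [apply: mulr_ge0 => //; exact: sqr_ge0|exact: sqr_ge0].
  have := sqr_ge0 (n%:R - 1 : R); have : 0 <= n%:R :> R by [].
  set a := _ + _ * n%:R ^+ 2 in h1 *; set m := (n%:R : R).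
  by nra.
have cK : K * harmonic n @[n --> \oo] --> (0 : R).
  by rewrite -[0](mulr0 K); apply: cvgMr; exact: cvg_harmonic.
apply: (@squeeze_cvgr _ _ _ _ (fun n => - (K * harmonic n))
   (fun n => K * harmonic n)) => //.
  by apply: nearW => n; rewrite -ler_norml H.
by rewrite -[0]oppr0; exact: cvgN.
Qed.

(** The integrand is the derivative of [pgauss p (s * x) * t (w * x)], which
    vanishes at infinity. *)
Lemma pgauss_ibp p s w (t dt : R -> R) : 0 < s ->
  (forall x : R, is_derive x (1 : R) t (dt x)) -> continuous dt ->
  (forall x, `|t x| <= 1) -> (forall x, `|dt x| <= 1) ->
  s * (\int[mu]_x (pgauss (dgauss p) (s * x) * t (w * x))) +
  w * (\int[mu]_x (pgauss p (s * x) * dt (w * x))) = 0.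
Proof.
move=> s0 td cdt t1 dt1.
have ct : continuous t := is_derive_continuous td.
have cM (c : R) (f : R -> R) : continuous f -> continuous (fun x : R => f (c * x)).
  move=> cf x; apply: (@continuous_comp _ _ _ (fun x : R => c * x) f); last exact: cf.
  exact: mulrl_continuous.
have ip q (u : R -> R) : continuous u -> (forall x, `|u x| <= 1) ->
    mu.-integrable setT (EFin \o (fun x => pgauss q (s * x) * u (w * x))).
  move=> cu u1; apply: (@le_integrable _ _ _ mu setT measurableT _
    (fun x => `|pgauss q (s * x)|%:E)).
  - apply/measurable_EFinP; apply: measurable_funM.
      exact: measurable_pgauss_scale.
    by apply: continuous_measurable_fun; exact: cM.
  - by move=> x _; rewrite !abse_EFin lee_fin normr_id normrM ler_piMr.
  - exact: (integrable_norm (integrable_pgauss_scale q s0)).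
have i1 := ip (dgauss p) t ct t1; have i2 := ip p dt cdt dt1.
rewrite -!RintegralZl//.
have iZ (c : R) (f : R -> R) : mu.-integrable setT (EFin \o f) ->
    mu.-integrable setT (EFin \o (fun x => c * f x)).
  by move=> fi; rewrite /comp; under eq_fun do rewrite EFinM; exact: integrableZl.
rewrite -RintegralD//; [|exact: iZ..].
have dlin (c x : R) : is_derive x (1 : R) (fun x => c * x) c.
  have -> : (fun x => c * x) = c \*: id by apply/funext.
  by apply: is_derive_eq; rewrite /GRing.scale/= mulr1.
apply: (@integral_derive_eq0 R (fun x => pgauss p (s * x) * t (w * x))).
- move=> x.
  have d1 := @is_derive1_comp R (pgauss p) _ x _ _ (is_derive_pgauss p _) (dlin s x).
  have d2 := @is_derive1_comp R t _ x _ _ (td _) (dlin w x).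
  have d3 := @is_deriveM _ _ _ _ x 1 _ _ d1 d2.
  apply: (@is_derive_eq _ _ _ _ _ _ _ _ d3).
  by rewrite /= /GRing.scale/=; ring.
- move=> x; apply: cvgD; apply: cvgMr.
    by apply: cvgM; [exact/(cM s)/continuous_pgauss|exact: (cM w t)].
  by apply: cvgM; [exact/(cM s)/continuous_pgauss|exact: (cM w dt)].
- have := integrableD measurableT (iZ s _ i1) (iZ w _ i2).
  by apply: eq_integrable.
- by apply: (@cvg_pgauss_scale p s (fun n => n%:R) (fun x => t (w * x))).
- apply: (@cvg_pgauss_scale p s (fun n => - n%:R) (fun x => t (w * x))) => //.
  by move=> n; rewrite sqrrN.
Qed.

(** Differentiating [pgauss p] multiplies its Fourier transform by the frequency.
    Taking moduli of both sides keeps only a positive factor, so that this step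
    can be iterated without following signs or powers of the imaginary unit. *)
Lemma wave_dgauss p s w : 0 < s ->
  s * cmod (wave (dgauss p) s w) = `|w| * cmod (wave p s w).
Proof.
move=> s0.
have ReE q : complex.Re (wave q s w) = \int[mu]_x (pgauss q (s * x) * cos (w * x)).
  by apply: eq_Rintegral => x _; rewrite ReM/= mul0r subr0.
have ImE q : complex.Im (wave q s w) = \int[mu]_x (pgauss q (s * x) * sin (w * x)).
  by apply: eq_Rintegral => x _; rewrite ImM/= mul0r addr0.
have sin1 (x : R) : `|sin x| <= 1 by rewrite ler_norml sin_geN1 sin_le1.
have cos1 (x : R) : `|cos x| <= 1 by rewrite ler_norml cos_geN1 cos_le1.
have E1 : s * complex.Re (wave (dgauss p) s w) = w * complex.Im (wave p s w).
  have := @pgauss_ibp p s w cos (fun x => - sin x) s0 (@is_derive_cos R).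
  have -> : \int[mu]_x (pgauss p (s * x) * - sin (w * x)) =
      - complex.Im (wave p s w).
    rewrite ImE -mulN1r -RintegralZl//; last first.
      have /cintegrableP[_] := cintegrable_wave p w s0.
      apply: eq_integrable => // x _.
      by rewrite ImM/= mul0r addr0.
    by apply: eq_Rintegral => x _; rewrite mulrN mulN1r.
  rewrite -ReE mulrN => H; apply/eqP; rewrite -subr_eq0; apply/eqP; apply: H => //.
    by move=> x; apply: cvgN; exact: continuous_sin.
  by move=> x; rewrite normrN.
have E2 : s * complex.Im (wave (dgauss p) s w) = - (w * complex.Re (wave p s w)).
  have := @pgauss_ibp p s w sin cos s0 (@is_derive_sin R).
  rewrite -ReE -ImE => H; apply/eqP; rewrite -subr_eq0 opprK; apply/eqP; apply: H => //.
  exact: continuous_cos.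
rewrite -{1}(ger0_norm (ltW s0)) -!cmod_real -!cmodM !cmodE.
rewrite !ReM !ImM/= !mul0r !subr0 !addr0 E1 E2 sqrrN addrC.
by [].
Qed.

(** Four integrations by parts trade the fourth power of the frequency for the
    polynomial [dgauss (dgauss (dgauss (dgauss p)))]. *)
Lemma wave_decay p : exists2 M, 0 <= M & forall s w, 0 < s ->
  cmod (wave p s w) <= M / s / (1 + (w / s) ^+ 4).
Proof.
have [A A0 hA] := wave_le p.
have [B B0 hB] := wave_le (dgauss (dgauss (dgauss (dgauss p)))).
exists (A + B) => [|s w s0]; first exact: addr_ge0.
rewrite ler_pdivlMr; last by rewrite ltr_pwDl// (exprM _ 2 2) sqr_ge0.
rewrite mulrDr mulr1 mulrDl lerD ?hA//.
apply: le_trans (hB s w s0).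
have sE q : cmod (wave (dgauss q) s w) = `|w / s| * cmod (wave q s w).
  rewrite normrM normfV (ger0_norm (ltW s0)) mulrAC -wave_dgauss//.
  by rewrite mulrAC divff ?mul1r// gt_eqF.
rewrite (sE (dgauss (dgauss (dgauss p)))) (sE (dgauss (dgauss p))).
rewrite (sE (dgauss p)) (sE p); set x := w / s; set c := cmod _.
have x4 : 0 <= x ^+ 4 by rewrite (exprM _ 2 2) sqr_ge0.
by rewrite -(ger0_norm x4) normrX le_eqVlt; apply/orP; left; apply/eqP; ring.
Qed.

End GaussianPolynomials.

(** * Fourier transforms of integrable functions *)

Section FourierPairing.
Variable R : realType.
Implicit Types (x y z xi : space3 R) (f g : space3 R -> R[i]).

Definition mu1 := [the {sigma_finite_measure set (measurableTypeR R) -> \bar R}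
  of @lebesgue_measure R].

(** The measure [leb3 R], carrying a sigma-finite structure. *)
Definition mu3 := [the {sigma_finite_measure set (space3 R) -> \bar R}
  of sprod (sprod mu1 mu1) mu1].

Lemma dotE x y : dot x y = x.1.1 * y.1.1 + x.1.2 * y.1.2 + x.2 * y.2.
Proof. by rewrite /dot /coord !big_ord_recr big_ord0/= add0r. Qed.

Lemma enormE x : enorm x = Num.sqrt (x.1.1 ^+ 2 + x.1.2 ^+ 2 + x.2 ^+ 2).
Proof. by rewrite /enorm dotE -!expr2. Qed.

Section Measurability.
Context d (T : measurableType d).
Implicit Types a b : T -> space3 R.

Lemma measurable_x1 a : measurable_fun setT a ->
  measurable_fun setT (fun t => (a t).1.1 : R).
Proof.
move=> ma; apply: (measurableT_comp (f := fst)); first exact: measurable_fst.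
by apply: (measurableT_comp (f := fst)) => //; exact: measurable_fst.
Qed.

Lemma measurable_x2 a : measurable_fun setT a ->
  measurable_fun setT (fun t => (a t).1.2 : R).
Proof.
move=> ma; apply: (measurableT_comp (f := snd)); first exact: measurable_snd.
by apply: (measurableT_comp (f := fst)) => //; exact: measurable_fst.
Qed.

Lemma measurable_x3 a : measurable_fun setT a ->
  measurable_fun setT (fun t => (a t).2 : R).
Proof.
by move=> ma; apply: (measurableT_comp (f := snd)) => //; exact: measurable_snd.
Qed.

Lemma measurable_dot a b : measurable_fun setT a -> measurable_fun setT b ->
  measurable_fun setT (fun t => dot (a t) (b t)).
Proof.
move=> ma mb; under eq_fun do rewrite dotE.
apply: measurable_funD; first apply: measurable_funD.
- by apply: measurable_funM; exact: measurable_x1.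
- by apply: measurable_funM; exact: measurable_x2.
- by apply: measurable_funM; exact: measurable_x3.
Qed.

End Measurability.

Definition fourier (c : R) f xi : R[i] :=
  cint mu3 (fun x => f x * cis (2 * pi * c * dot x xi)).

Lemma cmeasurable_phase (c : R) d (T : measurableType d) (a b : T -> space3 R) :
  measurable_fun setT a -> measurable_fun setT b ->
  cmeasurable (fun t => cis (2 * pi * c * dot (a t) (b t))).
Proof.
move=> ma mb; apply: cmeasurable_cis; apply: measurable_funM => //.
exact: measurable_dot.
Qed.

Lemma cmeasurable_fourier (c : R) f : cmeasurable f -> cmeasurable (fourier c f).
Proof.
move=> mf; apply: (cmeasurable_cint_section mu3
  (f := fun z : space3 R * space3 R => f z.2 * cis (2 * pi * c * dot z.2 z.1))).
apply: cmeasurableM; first exact: (cmeasurable_comp mf).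
by apply: cmeasurable_phase; [exact: measurable_snd|exact: measurable_fst].
Qed.

Lemma cintegrable_fourier (c : R) f xi : cintegrable mu3 f ->
  cintegrable mu3 (fun x => f x * cis (2 * pi * c * dot x xi)).
Proof.
move=> [mf fi]; apply: (@le_cintegrable _ _ _ mu3 _ (fun x => cmod (f x))) => //.
  apply: cmeasurableM => //; apply: cmeasurable_phase => //.
by move=> x; rewrite cmodM cmod_cis mulr1.
Qed.

Lemma cmod_fourier_le (c : R) f xi : cintegrable mu3 f ->
  cmod (fourier c f xi) <= \int[mu3]_x cmod (f x).
Proof.
move=> fi; rewrite (le_trans (cmod_cint_le (cintegrable_fourier c xi fi)))//.
rewrite le_eqVlt; apply/orP; left; apply/eqP; apply: eq_Rintegral => x _.
by rewrite cmodM cmod_cis mulr1.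
Qed.

(** The kernel of the Fourier multiplier of symbol [W], at the pair [p] of an input
    point [p.1] and an output point [p.2]. *)
Definition wkernel (W : space3 R -> R) (p : space3 R * space3 R) : R[i] :=
  cint mu3 (fun xi => (W xi)%:C%C * cis (2 * pi * (dot p.2 xi - dot p.1 xi))).

Lemma cmeasurable_wkernel W : measurable_fun setT W -> cmeasurable (wkernel W).
Proof.
move=> mW; apply: (cmeasurable_cint_section mu3
  (f := fun z : (space3 R * space3 R) * space3 R =>
    (W z.2)%:C%C * cis (2 * pi * (dot z.1.2 z.2 - dot z.1.1 z.2)))).
apply: cmeasurableM.
  by apply: cmeasurable_real; exact: (measurableT_comp mW).
apply: cmeasurable_cis; apply: measurable_funM => //; apply: measurable_funB.
  apply: measurable_dot; last exact: measurable_snd.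
  by apply: (measurableT_comp (f := snd)); [exact: measurable_snd|exact: measurable_fst].
apply: measurable_dot; last exact: measurable_snd.
by apply: (measurableT_comp (f := fst)); exact: measurable_fst.
Qed.

(** For an integrable weight [W] the three integrals, over the frequency and over
    the two space variables, converge absolutely together; exchanging them puts
    all the oscillation into the kernel of [W]. *)
Lemma fourier_pairing W f g : mu3.-integrable setT (EFin \o W) ->
  cintegrable mu3 f -> cintegrable mu3 g ->
  cintegrable (sprod mu3 mu3) (fun p => f p.1 * ((g p.2)^*)%C * wkernel W p) /\
  cint mu3 (fun xi => (W xi)%:C%C * (fourier (-1) f xi * ((fourier (-1) g xi)^*)%C)) =
  cint (sprod mu3 mu3) (fun p => f p.1 * ((g p.2)^*)%C * wkernel W p).
Proof.
move=> iW fi gi.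
have mW : measurable_fun setT W by apply/measurable_EFinP; exact: measurable_int iW.
pose ph (z : space3 R) (xi : space3 R) := cis (2 * pi * (-1) * dot z xi).
pose B (t : space3 R * (space3 R * space3 R)) : R[i] := (W t.1)%:C%C *
  ((f t.2.1 * ph t.2.1 t.1) * ((g t.2.2 * ph t.2.2 t.1)^*)%C).
have [mf fi1] := fi; have [mg gi1] := gi.
have mph d (T : measurableType d) (a b : T -> space3 R) :
    measurable_fun setT a -> measurable_fun setT b ->
    cmeasurable (fun t => ph (a t) (b t)).
  exact: cmeasurable_phase.
have m1 : measurable_fun setT (fun t : space3 R * (space3 R * space3 R) => t.1).
  exact: measurable_fst.
have m21 : measurable_fun setT (fun t : space3 R * (space3 R * space3 R) => t.2.1).
  by apply: (measurableT_comp (f := fst)); [exact: measurable_fst|exact: measurable_snd].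
have m22 : measurable_fun setT (fun t : space3 R * (space3 R * space3 R) => t.2.2).
  by apply: (measurableT_comp (f := snd)); exact: measurable_snd.
have iB : cintegrable (sprod mu3 (sprod mu3 mu3)) B.
  apply: (@le_cintegrable _ _ _ _ _
    (fun t => `|W t.1| * (cmod (f t.2.1) * cmod (g t.2.2)))).
  - apply: cmeasurableM.
      by apply: cmeasurable_real; exact: (measurableT_comp mW).
    apply: cmeasurableM.
      by apply: cmeasurableM; [exact: (cmeasurable_comp mf)|exact: mph].
    apply: cmeasurable_conj.
    by apply: cmeasurableM; [exact: (cmeasurable_comp mg)|exact: mph].
  - apply: (@integrable_sprodM _ _ _ _ _ mu3 (sprod mu3 mu3) (fun xi => `|W xi|)
      (fun p => cmod (f p.1) * cmod (g p.2))).
      exact: (integrable_norm iW).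
    exact: (integrable_sprodM (a := fun x => cmod (f x)) (b := fun x => cmod (g x))).
  - by move=> t; rewrite /B !cmodM cmod_real cmod_conj !cmodM !cmod_cis !mulr1.
(* Both sides are iterated integrals of the same function [B]. *)
have E1 xi : (W xi)%:C%C * (fourier (-1) f xi * ((fourier (-1) g xi)^*)%C) =
    cint (sprod mu3 mu3) (fun p => B (xi, p)).
  have i1 := cintegrable_fourier (-1) xi fi.
  have i2 := cintegrable_fourier (-1) xi gi.
  have i3 := cintegrable_conj i2.
  rewrite -cint_conj// -cint_sprodM// -cintZ//.
  exact: (cintegrable_sprodM i1 i3).
have E2 p : f p.1 * ((g p.2)^*)%C * wkernel W p = cint mu3 (fun xi => B (xi, p)).
  rewrite -cintZ; last first.
    apply: (@le_cintegrable _ _ _ mu3 _ (fun xi => `|W xi|)).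
    - apply: cmeasurableM; first exact: cmeasurable_real.
      apply: cmeasurable_cis; apply: measurable_funM => //.
      by apply: measurable_funB; exact: measurable_dot.
    - exact: (integrable_norm iW).
    - by move=> xi; rewrite cmodM cmod_real cmod_cis mulr1.
  apply: eq_cint => xi; rewrite /B /ph conjM conj_cis.
  have -> : 2 * pi * (dot p.2 xi - dot p.1 xi) =
      2 * pi * (-1) * dot p.1 xi + - (2 * pi * (-1) * dot p.2 xi) by ring.
  by rewrite cisD; ring.
have EF : (fun p => f p.1 * ((g p.2)^*)%C * wkernel W p) =
    (fun p => cint mu3 (fun xi => B (xi, p))) by apply/funext => p; exact: E2.
have -> : cint mu3 (fun xi => (W xi)%:C%C * (fourier (-1) f xi *
    ((fourier (-1) g xi)^*)%C)) = cint (sprod mu3 mu3) (fun p => f p.1 *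
    ((g p.2)^*)%C * wkernel W p).
  by rewrite EF -cint_Fubini//; apply: eq_cint.
split=> //.
have mK := cmeasurable_wkernel mW.
pose M := \int[mu3]_x `|W x|.
apply: (@le_cintegrable _ _ _ _ _ (fun p => M * (cmod (f p.1) * cmod (g p.2)))).
- apply: cmeasurableM => //; apply: cmeasurableM.
    exact: (cmeasurable_comp mf).
  by apply: cmeasurable_conj; exact: (cmeasurable_comp mg).
- under eq_fun do rewrite EFinM.
  apply: integrableZl => //.
  exact: (integrable_sprodM (a := fun x => cmod (f x)) (b := fun x => cmod (g x))).
- move=> p; rewrite !cmodM cmod_conj mulrC ler_wpM2r ?mulr_ge0 ?cmod_ge0//.
  apply: cmod_cint_le_bound.
  + apply: cmeasurableM; first exact: cmeasurable_real.
    apply: cmeasurable_cis; apply: measurable_funM => //.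
    by apply: measurable_funB; exact: measurable_dot.
  + exact: (integrable_norm iW).
  + by move=> xi; rewrite cmodM cmod_real cmod_cis mulr1.
Qed.

Lemma fourier_pairing_le W f g : mu3.-integrable setT (EFin \o W) ->
  cintegrable mu3 f -> cintegrable mu3 g ->
  ((cmod (cint mu3 (fun xi => (W xi)%:C%C *
    (fourier (-1) f xi * ((fourier (-1) g xi)^*)%C))))%:E <=
  \int[sprod mu3 mu3]_p (cmod (f p.1) * cmod (g p.2) * cmod (wkernel W p))%:E)%E.
Proof.
move=> iW fi gi; have [i0 ->] := fourier_pairing iW fi gi.
have [_ i1] := i0.
rewrite (le_trans (y := (\int[sprod mu3 mu3]_p
   cmod (f p.1 * ((g p.2)^*)%C * wkernel W p))%:E))//.
  by rewrite lee_fin; exact: cmod_cint_le.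
rewrite /Rintegral fineK; last exact: integrable_fin_num.
rewrite le_eqVlt; apply/orP; left; apply/eqP; apply: eq_integral => p _.
by rewrite !cmodM cmod_conj.
Qed.

End FourierPairing.

(** * Gaussian weights, their kernels, and the square norm of a Fourier transform *)

Section GaussianWeights.
Variable R : realType.
Implicit Types (x y z xi : space3 R) (f g : space3 R -> R[i]) (s a : R)
  (P : 'I_3 -> {poly R}).

Definition gweight P s xi : R :=
  pgauss (P 0) (s * xi.1.1) * pgauss (P 1) (s * xi.1.2) * pgauss (P 2) (s * xi.2).

Lemma gweightE P s xi : gweight P s xi =
  \prod_(j < 3) (P j).[s * Defs.coord j xi] * expR (- (s ^+ 2 * enorm xi ^+ 2)).
Proof.
rewrite enormE sqr_sqrtr ?addr_ge0 ?sqr_ge0//.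
have -> : - (s ^+ 2 * (xi.1.1 ^+ 2 + xi.1.2 ^+ 2 + xi.2 ^+ 2)) =
    - (s * xi.1.1) ^+ 2 - (s * xi.1.2) ^+ 2 - (s * xi.2) ^+ 2 by ring.
rewrite !expRD !big_ord_recr big_ord0/= mul1r /gweight /pgauss.
rewrite [P 0](_ : _ = P (widen_ord (leqnSn 2) (widen_ord (leqnSn 1) ord_max))); last first.
  by congr P; exact: val_inj.
rewrite [P 1](_ : _ = P (widen_ord (leqnSn 2) ord_max)); last first.
  by congr P; exact: val_inj.
rewrite [P 2](_ : _ = P ord_max); last by congr P; exact: val_inj.
rewrite /Defs.coord /=; ring.
Qed.

Lemma measurable_gweight P s : measurable_fun setT (gweight P s).
Proof.
have mp j : measurable_fun setT (fun t => pgauss (P j) (s * t)).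
  exact: measurable_pgauss_scale.
have mid : measurable_fun [set: space3 R] (fun xi => xi) by exact: measurable_id.
apply: measurable_funM; first apply: measurable_funM.
- exact: (measurableT_comp (mp 0) (measurable_x1 mid)).
- exact: (measurableT_comp (mp 1) (measurable_x2 mid)).
- exact: (measurableT_comp (mp 2) (measurable_x3 mid)).
Qed.

Lemma integrable_gweight P s : 0 < s -> (mu3 R).-integrable setT (EFin \o gweight P s).
Proof.
move=> s0.
have ip j : (mu1 R).-integrable setT (fun t => (pgauss (P j) (s * t))%:E).
  exact: integrable_pgauss_scale.
exact: (integrable_sprodM (integrable_sprodM (ip 0) (ip 1)) (ip 2)).
Qed.

(** The Gaussian weight is a product of functions of one coordinate, so its
    kernel factors through the one-dimensional integrals [wave]. *)
Lemma wkernel_gweight P s x y : 0 < s -> wkernel (gweight P s) (y, x) =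
  wave (P 0) s (2 * pi * (x.1.1 - y.1.1)) * wave (P 1) s (2 * pi * (x.1.2 - y.1.2)) *
  wave (P 2) s (2 * pi * (x.2 - y.2)).
Proof.
move=> s0.
have iw j w : cintegrable (mu1 R)
    (fun t => (pgauss (P j) (s * t))%:C%C * cis (w * t)).
  exact: cintegrable_wave.
set w1 := 2 * pi * (x.1.1 - y.1.1); set w2 := 2 * pi * (x.1.2 - y.1.2).
set w3 := 2 * pi * (x.2 - y.2).
have i12 := cintegrable_sprodM (iw 0 w1) (iw 1 w2).
rewrite /wave -[X in X * _](cint_sprodM (iw 0 w1) (iw 1 w2)).
rewrite -(cint_sprodM i12 (iw 2 w3)).
apply: eq_cint => xi /=.
have -> : 2 * pi * (dot x xi - dot y xi) =
    w1 * xi.1.1 + w2 * xi.1.2 + w3 * xi.2.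
  by rewrite !dotE /w1 /w2 /w3; ring.
by rewrite !cisD /gweight !rmorphM; ring.
Qed.

Lemma gweight_kernel_le P : exists2 M, 0 <= M & forall s x y, 0 < s ->
  cmod (wkernel (gweight P s) (y, x)) <= (M / s) ^+ 3 *
   ((1 + (2 * pi * (x.1.1 - y.1.1) / s) ^+ 4)^-1 *
    (1 + (2 * pi * (x.1.2 - y.1.2) / s) ^+ 4)^-1 *
    (1 + (2 * pi * (x.2 - y.2) / s) ^+ 4)^-1).
Proof.
have [A A0 hA] := wave_decay (P 0).
have [B B0 hB] := wave_decay (P 1).
have [C C0 hC] := wave_decay (P 2).
exists (A + B + C) => [|s x y s0]; first by rewrite !addr_ge0.
have v0 w : 0 <= (1 + (w / s) ^+ 4)^-1 :> R.
  by rewrite invr_ge0 addr_ge0// (exprM _ 2 2) sqr_ge0.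
rewrite wkernel_gweight// !cmodM.
have si0 : 0 <= s^-1 by rewrite invr_ge0 ltW.
set K := _ / s.
have h1 w : cmod (wave (P 0) s w) <= K * (1 + (w / s) ^+ 4)^-1.
  by rewrite (le_trans (hA s w s0))// ler_wpM2r// ler_wpM2r// -addrA lerDl addr_ge0.
have h2 w : cmod (wave (P 1) s w) <= K * (1 + (w / s) ^+ 4)^-1.
  by rewrite (le_trans (hB s w s0))// ler_wpM2r// ler_wpM2r// -addrA addrCA lerDl addr_ge0.
have h3 w : cmod (wave (P 2) s w) <= K * (1 + (w / s) ^+ 4)^-1.
  by rewrite (le_trans (hC s w s0))// ler_wpM2r// ler_wpM2r// lerDr addr_ge0.
set u1 := 2 * pi * (x.1.1 - y.1.1); set u2 := 2 * pi * (x.1.2 - y.1.2).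
set u3 := 2 * pi * (x.2 - y.2).
rewrite [leRHS](_ : _ = (K * (1 + (u1 / s) ^+ 4)^-1) * (K * (1 + (u2 / s) ^+ 4)^-1) *
  (K * (1 + (u3 / s) ^+ 4)^-1)); last by ring.
by rewrite ler_pM ?mulr_ge0 ?cmod_ge0// ler_pM ?cmod_ge0.
Qed.

Lemma inv1X4_le1 (t : R) : (1 + t ^+ 4)^-1 <= 1.
Proof. by rewrite invf_le1 ?ltr_pwDl// ?lerDl (exprM _ 2 2) sqr_ge0. Qed.

Lemma inv1X4_ge0 (t : R) : 0 <= (1 + t ^+ 4)^-1.
Proof. by rewrite invr_ge0 addr_ge0// (exprM _ 2 2) sqr_ge0. Qed.

(** A single far coordinate is enough, the factors of the two other coordinates
    being at most 1. The frequency attached to a difference [t] of coordinates is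
    [2 * pi * t], of modulus at least [`|t|]. *)
Lemma gweight_kernel_far P : exists2 M, 0 <= M & forall s (delta : R) x y,
  0 < s -> 0 <= delta ->
  delta <= `|x.1.1 - y.1.1| \/ delta <= `|x.1.2 - y.1.2| ->
  cmod (wkernel (gweight P s) (y, x)) <= M / s ^+ 3 / (1 + (delta / s) ^+ 4).
Proof.
have [M M0 hM] := gweight_kernel_le P.
exists (M ^+ 3) => [|s delta x y s0 d0 far]; first exact: exprn_ge0.
apply: (le_trans (hM s x y s0)).
rewrite expr_div_n ler_wpM2l ?divr_ge0 ?exprn_ge0 ?(ltW s0)//.
have pi1 : 1 <= 2 * pi :> R by have := @pi_ge2 R; lra.
have far_le t : delta <= `|t| ->
    (1 + (2 * pi * t / s) ^+ 4)^-1 <= (1 + (delta / s) ^+ 4)^-1.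
  have t4 (u : R) : 0 <= u ^+ 4 by rewrite (exprM _ 2 2) sqr_ge0.
  move=> dt; rewrite lef_pV2 ?posrE ?ltr_pwDl ?t4// lerD2l.
  rewrite -[leRHS](ger0_norm (t4 _)) normrX lerXn2r ?nnegrE ?divr_ge0 ?(ltW s0)//.
  rewrite !normrM normfV (gtr0_norm s0) ler_wpM2r ?invr_ge0 ?(ltW s0)//.
  rewrite -normrM (ger0_norm (le_trans ler01 pi1)) (le_trans dt)// ler_peMl//.
case: far => /far_le h.
  rewrite -[leRHS]mulr1 ler_pM ?mulr_ge0 ?inv1X4_ge0 ?inv1X4_le1//.
  by rewrite -[leRHS]mulr1 ler_pM ?inv1X4_ge0 ?inv1X4_le1.
rewrite -[leRHS]mulr1 ler_pM ?mulr_ge0 ?inv1X4_ge0 ?inv1X4_le1//.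
by rewrite -[leRHS]mul1r ler_pM ?inv1X4_ge0 ?inv1X4_le1.
Qed.

(** A majorant of the kernels that is integrable in each of its two points. *)
Definition lorentz3 a y x : R :=
  lorentz a (- (a * y.1.1)) x.1.1 * lorentz a (- (a * y.1.2)) x.1.2 *
  lorentz a (- (a * y.2)) x.2.

Lemma lorentz3C a x y : lorentz3 a x y = lorentz3 a y x.
Proof.
have E (u v : R) : lorentz a (- (a * u)) v = lorentz a (- (a * v)) u.
  by rewrite /lorentz; congr (_^-1); ring.
by rewrite /lorentz3 (E x.1.1) (E x.1.2) (E x.2).
Qed.

Lemma lorentz3_ge0 a x y : 0 <= lorentz3 a x y.
Proof. by rewrite !mulr_ge0 ?ltW ?lorentz_gt0. Qed.

Lemma integral_lorentz3_le a y : 0 < a ->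
  (\int[mu3 R]_x (lorentz3 a y x)%:E <= ((pi / a) ^+ 3)%:E)%E.
Proof.
move=> a0.
have mc b : measurable_fun [set: measurableTypeR R] (lorentz a b).
  exact: measurable_lorentz.
have c0 b t : 0 <= lorentz a b t by exact/ltW/lorentz_gt0.
have ic b : (\int[mu1 R]_x (lorentz a b x)%:E <= (pi / a)%:E)%E.
  exact: integral_lorentz_le.
have ic0 b : (0 <= \int[mu1 R]_x (lorentz a b x)%:E)%E.
  by apply: integral_ge0 => x _; rewrite lee_fin.
rewrite (@ge0_integral_sprodM _ _ _ _ R (sprod (mu1 R) (mu1 R)) (mu1 R)
  (fun q => lorentz a (- (a * y.1.1)) q.1 * lorentz a (- (a * y.1.2)) q.2)
  (lorentz a (- (a * y.2))))//.
- rewrite (@ge0_integral_sprodM _ _ _ _ R (mu1 R) (mu1 R)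
    (lorentz a (- (a * y.1.1))) (lorentz a (- (a * y.1.2))))//.
  by rewrite exprSr expr2 !EFinM; apply: lee_pmul => //; [exact: mule_ge0|exact: lee_pmul].
- apply: measurable_funM.
    by apply: (measurableT_comp (mc _)); exact: measurable_fst.
  by apply: (measurableT_comp (mc _)); exact: measurable_snd.
- by move=> q; rewrite mulr_ge0.
Qed.

Lemma inv1X4_le (t : R) : (1 + t ^+ 4)^-1 <= 2 * (1 + t ^+ 2)^-1.
Proof.
rewrite ler_pdivlMr ?ltr_pwDl ?sqr_ge0// mulrC ler_pdivrMr; last first.
  by rewrite ltr_pwDl// (exprM _ 2 2) sqr_ge0.
rewrite (exprM t 2 2); have := sqr_ge0 (t ^+ 2 - 1); have := sqr_ge0 t.
by move: (t ^+ 2) => u; nra.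
Qed.

(** Decay of order two in each coordinate is enough to integrate the kernel; the
    rest of the decay of order four is given up. *)
Lemma gweight_kernel_le_lorentz P : exists2 M, 0 <= M & forall s x y, 0 < s ->
  cmod (wkernel (gweight P s) (y, x)) <=
    (M / s) ^+ 3 * lorentz3 (2 * pi / s) y x.
Proof.
have [M M0 hM] := gweight_kernel_le P.
exists (2 * M) => [|s x y s0]; first by rewrite mulr_ge0.
apply: (le_trans (hM s x y s0)).
have E (u v : R) : lorentz (2 * pi / s) (- (2 * pi / s * v)) u =
    (1 + (2 * pi * (u - v) / s) ^+ 2)^-1.
  by rewrite /lorentz; congr (_^-1); ring.
rewrite /lorentz3 !E.
set u1 := 2 * pi * (x.1.1 - y.1.1) / s; set u2 := 2 * pi * (x.1.2 - y.1.2) / s.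
set u3 := 2 * pi * (x.2 - y.2) / s.
rewrite [leRHS](_ : _ = (M / s) ^+ 3 * ((2 * (1 + u1 ^+ 2)^-1) *
  (2 * (1 + u2 ^+ 2)^-1) * (2 * (1 + u3 ^+ 2)^-1))); last first.
  by rewrite !expr_div_n exprMn; move: (1 + u1 ^+ 2) => c1; ring.
rewrite ler_wpM2l ?exprn_ge0 ?divr_ge0 ?(ltW s0)//.
by rewrite ler_pM ?mulr_ge0 ?inv1X4_ge0 ?inv1X4_le// ler_pM ?inv1X4_ge0 ?inv1X4_le.
Qed.

(** Half of Plancherel's theorem: the Gaussian means of [cmod (fourier (-1) g) ^+ 2]
    are quadratic forms in [g] whose kernels have rows and columns of bounded
    integral, so that they are bounded by the square norm of [g] uniformly in
    the width [s^-1] of the Gaussian. *)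
Lemma gauss_mean_fourier_le : exists2 M : R, 0 <= M & forall s g, 0 < s ->
  cintegrable (mu3 R) g ->
  (\int[mu3 R]_xi (gweight (fun=> 1%:P) s xi * cmod (fourier (-1) g xi) ^+ 2)%:E <=
   M%:E * \int[mu3 R]_x (cmod (g x) ^+ 2)%:E)%E.
Proof.
have [M M0 hM] := gweight_kernel_le_lorentz (fun=> 1%:P).
exists ((M / 2) ^+ 3) => [|s g s0 gi]; first by rewrite exprn_ge0// divr_ge0.
set W := gweight _ s; have iW : (mu3 R).-integrable setT (EFin \o W).
  exact: integrable_gweight.
have mW : measurable_fun setT W by exact: measurable_gweight.
have W0 xi : 0 <= W xi.
  by rewrite /W /gweight /pgauss !hornerC !mul1r !mulr_ge0 ?expR_ge0.
have {}hM x y : cmod (wkernel W (y, x)) <= (M / s) ^+ 3 * lorentz3 (2 * pi / s) y x.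
  exact: hM.
clearbody W.
have [mg gi1] := gi.
have mcg := measurable_cmod mg.
have mF := cmeasurable_fourier (-1) mg.
set F := fourier (-1) g in mF *.
have iWF : (mu3 R).-integrable setT (fun xi => (W xi * cmod (F xi) ^+ 2)%:E).
  pose N := \int[mu3 R]_x cmod (g x).
  apply: (@le_integrable _ _ _ _ setT measurableT _ (fun xi => (N ^+ 2 * W xi)%:E)) => //.
  - apply/measurable_EFinP/measurable_funM => //.
    by apply: measurable_funX; exact: measurable_cmod.
  - move=> xi _; rewrite !abse_EFin lee_fin.
    rewrite (ger0_norm (mulr_ge0 (W0 xi) (sqr_ge0 _))).
    rewrite (ger0_norm (mulr_ge0 (sqr_ge0 _) (W0 xi))) mulrC ler_wpM2r// lerXn2r ?nnegrE ?cmod_ge0//.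
      by apply: Rintegral_ge0 => x _; exact: cmod_ge0.
    exact: cmod_fourier_le.
  - by under eq_fun do rewrite EFinM; exact: integrableZl.
have := fourier_pairing_le iW gi gi.
rewrite -/F.
have -> : cint (mu3 R) (fun xi => (W xi)%:C%C * (F xi * ((F xi)^*)%C)) =
    (\int[mu3 R]_xi (W xi * cmod (F xi) ^+ 2))%:C%C.
  have E xi : (W xi)%:C%C * (F xi * ((F xi)^*)%C) = (W xi * cmod (F xi) ^+ 2)%:C%C.
    apply/eqP; rewrite eq_complex !ReM !ImM Re_conj Im_conj sqr_cmod /=.
    by apply/andP; split; apply/eqP; ring.
  by rewrite (eq_cint _ E) cint_real.
rewrite cmod_real ger0_norm; last first.
  by apply: Rintegral_ge0 => xi _; rewrite mulr_ge0 ?sqr_ge0.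
rewrite /Rintegral fineK; last exact: integrable_fin_num.
move=> /le_trans; apply.
pose a := 2 * pi / s : R.
have a0 : 0 < a by rewrite divr_gt0// mulr_gt0// pi_gt0.
pose c := (M / s) ^+ 3 / 2.
have c0 : 0 <= c by rewrite divr_ge0// exprn_ge0// divr_ge0 ?(ltW s0).
have mK : measurable_fun setT (fun p : space3 R * space3 R => lorentz3 a p.1 p.2).
  have mc (u v : space3 R * space3 R -> R) : measurable_fun setT u ->
      measurable_fun setT v -> measurable_fun setT (fun p => lorentz a (- (a * u p)) (v p)).
    move=> mu mv; rewrite /lorentz.
    apply: (measurableT_comp (f := fun t : R => (1 + t ^+ 2)^-1)).
      apply: continuous_measurable_fun.
      have -> : (fun t : R => (1 + t ^+ 2)^-1) = lorentz 1 0.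
        by apply/funext => t; rewrite /lorentz mul1r addr0.
      exact: continuous_lorentz.
    apply: measurable_funD; first exact: measurable_funM.
    by apply: measurableT_comp => //; exact: measurable_funM.
  have m1 : measurable_fun setT (fun p : space3 R * space3 R => p.1) by exact: measurable_fst.
  have m2 : measurable_fun setT (fun p : space3 R * space3 R => p.2) by exact: measurable_snd.
  apply: measurable_funM; first apply: measurable_funM; apply: mc.
  - exact: (measurable_x1 m1).
  - exact: (measurable_x1 m2).
  - exact: (measurable_x2 m1).
  - exact: (measurable_x2 m2).
  - exact: (measurable_x3 m1).
  - exact: (measurable_x3 m2).
pose h1 (p : space3 R * space3 R) := c * (cmod (g p.1) ^+ 2 * lorentz3 a p.1 p.2).
pose h2 (p : space3 R * space3 R) := c * (cmod (g p.2) ^+ 2 * lorentz3 a p.1 p.2).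
have mg1 : measurable_fun setT (fun p : space3 R * space3 R => cmod (g p.1)).
  exact: (measurableT_comp mcg).
have mg2 : measurable_fun setT (fun p : space3 R * space3 R => cmod (g p.2)).
  exact: (measurableT_comp mcg).
have mh1 : measurable_fun setT h1.
  by apply: measurable_funM => //; apply: measurable_funM => //; exact: measurable_funX.
have mh2 : measurable_fun setT h2.
  by apply: measurable_funM => //; apply: measurable_funM => //; exact: measurable_funX.
have h10 p : (0 <= (h1 p)%:E)%E.
  by rewrite lee_fin; exact: (mulr_ge0 c0 (mulr_ge0 (sqr_ge0 _) (lorentz3_ge0 _ _ _))).
have h20 p : (0 <= (h2 p)%:E)%E.
  by rewrite lee_fin; exact: (mulr_ge0 c0 (mulr_ge0 (sqr_ge0 _) (lorentz3_ge0 _ _ _))).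
(* Schur's test: the product of two values of [g] is at most the half sum of
   their squares, and each square is integrated against a row or a column. *)
apply: (@le_trans _ _ (\int[sprod (mu3 R) (mu3 R)]_p ((h1 p)%:E + (h2 p)%:E))%E).
  apply: ge0_le_integral => //.
  - by move=> p _; rewrite lee_fin !mulr_ge0 ?cmod_ge0.
  - apply/measurable_EFinP/measurable_funM; first exact: measurable_funM.
    by apply: measurable_cmod; exact: cmeasurable_wkernel.
  - by apply: emeasurable_funD; exact/measurable_EFinP.
  - move=> [y x] _; rewrite -EFinD lee_fin /h1 /h2 /= -mulrDr -mulrDl.
    apply: (@le_trans _ _ (cmod (g y) * cmod (g x) * ((M / s) ^+ 3 * lorentz3 a y x))).
      by rewrite ler_wpM2l ?mulr_ge0 ?cmod_ge0 ?hM.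
    have K0 : 0 <= (M / s) ^+ 3 * lorentz3 a y x.
      by rewrite mulr_ge0 ?lorentz3_ge0// exprn_ge0// divr_ge0 ?(ltW s0).
    rewrite [leRHS](_ : _ = (cmod (g y) ^+ 2 + cmod (g x) ^+ 2) / 2 *
      ((M / s) ^+ 3 * lorentz3 a y x)); last by rewrite /c; ring.
    rewrite ler_wpM2r//; have := sqr_ge0 (cmod (g y) - cmod (g x)).
    by move: (cmod (g y)) (cmod (g x)) => b d; nra.
pose G := (\int[mu3 R]_x (cmod (g x) ^+ 2)%:E)%E.
have G0 : (0 <= G)%E by apply: integral_ge0 => x _; rewrite lee_fin sqr_ge0.
have mgg : measurable_fun setT (fun x => (cmod (g x) ^+ 2)%:E).
  by apply/measurable_EFinP; exact: measurable_funX.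
have mcy y : measurable_fun setT (fun x : space3 R => lorentz3 a y x).
  exact: (measurableT_comp (f := fun p : space3 R * space3 R => lorentz3 a p.1 p.2)
    mK (pair1_measurable y)).
have row y : (\int[mu3 R]_x (c * (cmod (g y) ^+ 2 * lorentz3 a y x))%:E <=
    (c * (pi / a) ^+ 3)%:E * (cmod (g y) ^+ 2)%:E)%E.
  under eq_integral do rewrite mulrA EFinM.
  rewrite ge0_integralZl//; first last.
  - by rewrite lee_fin mulr_ge0// sqr_ge0.
  - by move=> x _; rewrite lee_fin lorentz3_ge0.
  - exact/measurable_EFinP.
  rewrite [leRHS](_ : _ = (c * cmod (g y) ^+ 2)%:E * ((pi / a) ^+ 3)%:E)%E; last first.
    by rewrite -!EFinM; congr EFin; ring.
  apply: lee_wpmul2l.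
    by rewrite lee_fin mulr_ge0// sqr_ge0.
  exact: integral_lorentz3_le.
have cE : c * (pi / a) ^+ 3 * 2 = (M / 2) ^+ 3.
  have sN0 : s != 0 by rewrite gt_eqF.
  have piN0 : pi != 0 :> R by rewrite gt_eqF// pi_gt0.
  by rewrite /c /a; move: (pi : R) piN0 => q qN0; field; rewrite sN0 qN0.
have bnd : (\int[mu3 R]_y ((c * (pi / a) ^+ 3)%:E * (cmod (g y) ^+ 2)%:E) =
    (c * (pi / a) ^+ 3)%:E * G)%E.
  rewrite ge0_integralZl//.
  - by move=> y _; rewrite lee_fin sqr_ge0.
  - by rewrite lee_fin mulr_ge0// exprn_ge0// divr_ge0 ?pi_ge0// ltW.
rewrite ge0_integralD//; [|exact/measurable_EFinP..].
rewrite (fubini_tonelli1 (m1 := mu3 R) (m2 := mu3 R) (EFin \o h1))//; last first.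
  exact/measurable_EFinP.
rewrite (fubini_tonelli2 (m1 := mu3 R) (m2 := mu3 R) (EFin \o h2))//; last first.
  exact/measurable_EFinP.
have k0 : (0 <= (c * (pi / a) ^+ 3)%:E)%E.
  by rewrite lee_fin mulr_ge0// exprn_ge0// divr_ge0 ?pi_ge0// ltW.
rewrite -cE -/G mulr_natr mulr2n EFinD ge0_muleDl//.
have mr : measurable_fun setT
    (fun y => (c * (pi / a) ^+ 3)%:E * (cmod (g y) ^+ 2)%:E)%E.
  exact: measurable_funeM.
apply: leeD; rewrite -bnd; apply: ge0_le_integral => //.
- by move=> y _; apply: integral_ge0 => x _; exact: h10.
- by apply: measurable_fun_fubini_tonelli_F => //; exact/measurable_EFinP.
- by move=> y _; exact: row.
- by move=> y _; apply: integral_ge0 => x _; exact: h20.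
- by apply: measurable_fun_fubini_tonelli_G => //; exact/measurable_EFinP.
- move=> x _; apply: le_trans (row x); rewrite le_eqVlt; apply/orP; left; apply/eqP.
  by apply: eq_integral => y _; rewrite /= /h2/= lorentz3C.
Qed.

(** As the Gaussian widens, its means of [cmod (fourier (-1) g) ^+ 2] increase to
    the full integral. *)
Lemma csquare_integrable_fourier g : cintegrable (mu3 R) g ->
  csquare_integrable (mu3 R) g -> csquare_integrable (mu3 R) (fourier (-1) g).
Proof.
move=> gi [mg /L2norm_lty g2].
have mF := cmeasurable_fourier (-1) mg.
split=> //; apply/L2norm_lty.
have [M M0 hM] := gauss_mean_fourier_le.
apply: (@le_lt_trans _ _ (M%:E * \int[mu3 R]_x (cmod (g x) ^+ 2)%:E)%E); last first.
  by apply: lte_mul_pinfty => //; rewrite lee_fin.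
pose W n := gweight (fun=> 1%:P) (n.+1%:R^-1 : R).
pose F xi := cmod (fourier (-1) g xi) ^+ 2.
have WE n xi : W n xi = expR (- (n.+1%:R^-1 ^+ 2 * enorm xi ^+ 2)).
  by rewrite /W gweightE big1 ?mul1r// => j _; rewrite hornerC.
have mFF : measurable_fun setT F by apply: measurable_funX; exact: measurable_cmod.
have h1 : (fun n => n.+1%:R^-1 : R) @ \oo --> (0 : R) by exact: cvg_harmonic.
have h2 : (fun n => n.+1%:R^-1 ^+ 2 : R) @ \oo --> (0 : R).
  have -> : (0 : R) = 0 ^+ 2 by rewrite expr0n.
  exact: (@cvg_comp _ _ _ _ (fun x : R => x ^+ 2) _ _ _ h1 (@exprn_continuous R 2 0)).
have cv : (\int[mu3 R]_xi (W n xi * F xi)%:E)%E @[n --> \oo] -->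
    (\int[mu3 R]_xi (F xi)%:E)%E.
  have -> : (\int[mu3 R]_xi (F xi)%:E = \int[mu3 R]_xi limn (fun n => (W n xi * F xi)%:E))%E.
    apply: eq_integral => xi _; apply/esym/cvg_lim => //.
    apply: cvg_EFin; first exact: nearW.
    rewrite -[X in _ --> X]mul1r; apply: cvgMl.
    under eq_fun do rewrite WE.
    have h3 : (fun n => - (n.+1%:R^-1 ^+ 2 * enorm xi ^+ 2)) @ \oo --> (0 : R).
      have -> : (0 : R) = - (0 * enorm xi ^+ 2) by rewrite mul0r oppr0.
      by apply: cvgN; exact: (cvgMl h2).
    have := @cvg_comp _ _ _ _ (@expR R) _ _ _ h3 (@continuous_expR R 0).
    by rewrite expR0.
  apply: cvg_monotone_convergence => //.
  - move=> n; apply/measurable_EFinP/measurable_funM => //.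
    exact: measurable_gweight.
  - by move=> n xi _; rewrite lee_fin mulr_ge0 ?sqr_ge0// WE expR_ge0.
  - move=> xi _ m n mn; rewrite lee_fin ler_wpM2r ?sqr_ge0// !WE ler_expR lerN2.
    rewrite ler_wpM2r ?sqr_ge0// lerXn2r ?nnegrE ?invr_ge0//.
    by rewrite lef_pV2 ?posrE ?ltr0n// ler_nat.
rewrite -(cvg_lim _ cv)//; apply: lime_le; first by apply/cvg_ex; eexists; exact: cv.
by apply: nearW => n; apply: hM.
Qed.

End GaussianWeights.

(** * The symbol as a superposition of Gaussian weights *)

Section Subordination.
Variable R : realType.
Implicit Types (x y xi : space3 R) (f g : space3 R -> R[i]) (s t a b : R).

(** The integral of [r * expR (- r)] in [r] from [t] to infinity, which decreases
    from 1 at 0 to 0 at infinity. *)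
Definition psi t : R := (1 + t) * expR (- t).

Lemma psi_ge0 t : 0 <= t -> 0 <= psi t.
Proof. by move=> t0; rewrite mulr_ge0 ?expR_ge0// addr_ge0. Qed.

Lemma psi_le1 t : psi t <= 1.
Proof. by rewrite /psi expRN ler_pdivrMr ?expR_gt0// mul1r expR_ge1Dx. Qed.

(** A smooth spectral cutoff to frequencies of modulus roughly between [b^-1] and
    [a^-1]. *)
Definition cutoff a b xi : R :=
  psi (a ^+ 2 * enorm xi ^+ 2) - psi (b ^+ 2 * enorm xi ^+ 2).

Lemma normr_cutoff_le1 a b xi : `|cutoff a b xi| <= 1.
Proof.
have h c : 0 <= psi (c ^+ 2 * enorm xi ^+ 2) <= 1.
  by rewrite psi_le1 psi_ge0// mulr_ge0 ?sqr_ge0.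
rewrite /cutoff; have /andP[] := h a; have /andP[] := h b.
move: (psi _) (psi _) => u v u0 u1 v0 v1; rewrite ler_norml; lra.
Qed.

Lemma sqr_enorm xi : enorm xi ^+ 2 = dot xi xi.
Proof. by rewrite /enorm sqr_sqrtr// dotE !addr_ge0// -expr2 sqr_ge0. Qed.

Lemma measurable_coord j : measurable_fun setT (@Defs.coord R j).
Proof.
have mid : measurable_fun [set: space3 R] (fun xi => xi) by exact: measurable_id.
have m1 := measurable_x1 mid; have m2 := measurable_x2 mid.
have m3 := measurable_x3 mid.
by case: j => [[|[|[|//]]] jlt].
Qed.

Lemma measurable_sqr_enorm : measurable_fun setT (fun xi => enorm xi ^+ 2).
Proof.
under eq_fun do rewrite sqr_enorm.
by apply: measurable_dot; exact: measurable_id.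
Qed.

Lemma coord_sqr_le j xi : Defs.coord j xi ^+ 2 <= enorm xi ^+ 2.
Proof.
rewrite sqr_enorm /dot (bigD1 j)//= -expr2 lerDl; apply: sumr_ge0 => i _.
by rewrite -expr2 sqr_ge0.
Qed.

Variables (k h : 'I_3).
Hypothesis hkh : k != h.

Definition symbol_num xi : R := Defs.coord k xi ^+ 2 * Defs.coord h xi ^+ 2.

Lemma symbol_num_ge0 xi : 0 <= symbol_num xi.
Proof. by rewrite mulr_ge0 ?sqr_ge0. Qed.

Lemma symbol_num_le xi : symbol_num xi <= enorm xi ^+ 4.
Proof. by rewrite (exprM _ 2 2) (expr2 (enorm xi ^+ 2)) ler_pM ?sqr_ge0 ?coord_sqr_le. Qed.

Lemma riesz_symbolM xi : riesz_symbol k h xi * enorm xi ^+ 4 = symbol_num xi.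
Proof.
rewrite /riesz_symbol -/(symbol_num xi).
have [e0|e0] := eqVneq (enorm xi) 0; last by rewrite divfK// expf_neq0.
apply/eqP; rewrite e0 expr0n/= mulr0 eq_le symbol_num_ge0 andbC/=.
by rewrite (le_trans (symbol_num_le xi))// e0 expr0n.
Qed.

Lemma normr_riesz_symbol_le1 xi : `|riesz_symbol k h xi| <= 1.
Proof.
have e4 : 0 <= enorm xi ^+ 4 by rewrite (exprM _ 2 2) sqr_ge0.
rewrite ger0_norm; last by rewrite divr_ge0 ?symbol_num_ge0.
have [e0|e0] := eqVneq (enorm xi) 0.
  by rewrite /riesz_symbol e0 expr0n/= invr0 mulr0.
by rewrite ler_pdivrMr ?mul1r ?symbol_num_le// lt_neqAle eq_sym expf_neq0.
Qed.

Lemma measurable_symbol_num : measurable_fun setT symbol_num.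
Proof. by apply: measurable_funM; apply: measurable_funX; exact: measurable_coord. Qed.

Lemma measurable_riesz_symbol : measurable_fun setT (@riesz_symbol R k h).
Proof.
apply: measurable_funM; first exact: measurable_symbol_num.
have -> : (fun xi : space3 R => (enorm xi ^+ 4)^-1) =
    (fun u => u `^ (- 2)) \o (fun xi => enorm xi ^+ 2).
  apply/funext => xi /=; rewrite powRN powR_mulrn ?sqr_ge0//.
  by rewrite -exprM.
apply: (measurableT_comp (measurable_powR _)); exact: measurable_sqr_enorm.
Qed.

Definition riesz_poly (j : 'I_3) : {poly R} := if (j == k) || (j == h) then 'X^2 else 1%:P.

Lemma gweight_riesz s xi : gweight riesz_poly s xi =
  s ^+ 4 * (symbol_num xi * expR (- (s ^+ 2 * enorm xi ^+ 2))).
Proof.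
rewrite gweightE mulrA; congr (_ * _).
rewrite (bigD1 k)//= (bigD1 h)/=; last by rewrite eq_sym.
rewrite big1; last first.
  by move=> j /andP[jk jh]; rewrite /riesz_poly (negPf jk) (negPf jh) hornerC.
rewrite /riesz_poly !eqxx orbT !hornerXn /symbol_num; ring.
Qed.

(** The integrand is the derivative in [s] of the symbol times
    [- psi (s ^+ 2 * enorm xi ^+ 2)]. The denominator [enorm xi ^+ 4] of the
    symbol is traded for a superposition of Gaussian weights, each of which has a
    kernel of product form. *)
Lemma subordination a b xi : a <= b ->
  (\int[@lebesgue_measure R]_(s in `[a, b]) (2 * s ^+ 3 *
    (symbol_num xi * expR (- (s ^+ 2 * enorm xi ^+ 2))))%:E =
  (riesz_symbol k h xi * cutoff a b xi)%:E)%E.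
Proof.
move=> ab; set c := enorm xi ^+ 2; set m := riesz_symbol k h xi.
pose H s := - (m * psi (s ^+ 2 * c)).
have cE : symbol_num xi = m * c ^+ 2 by rewrite -riesz_symbolM /c -exprM.
have dH s : is_derive s 1 H (2 * s ^+ 3 * (symbol_num xi * expR (- (s ^+ 2 * c)))).
  have d1 : is_derive s 1 (fun s => s ^+ 2 * c) (2 * s * c).
    have -> : (fun s => s ^+ 2 * c) = c \*: (id ^+ 2).
      by apply/funext => u; rewrite /= mulrC.
    by apply: is_derive_eq; rewrite expr1 /GRing.scale/= mulr1; ring.
  have d2 := @is_derive1_comp R expR (fun s => - (s ^+ 2 * c)) s _ _ (is_derive_expR _)
    (is_deriveN d1).
  have d3 : is_derive s 1 (fun s => 1 + s ^+ 2 * c) (2 * s * c).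
    have -> : (fun s => 1 + s ^+ 2 * c) = cst 1 + (fun s => s ^+ 2 * c) by apply/funext.
    by apply: is_derive_eq; rewrite add0r.
  have d4 := @is_deriveZ _ _ _ _ (- m) s 1 _ (@is_deriveM _ _ _ _ s 1 _ _ d3 d2).
  have -> : H = (- m) \*: ((fun s => 1 + s ^+ 2 * c) * (expR \o (fun s => - (s ^+ 2 * c)))).
    by apply/funext => u; rewrite /H /psi /= /GRing.scale/= -mulNr.
  apply: (@is_derive_eq _ _ _ _ _ _ _ _ d4).
  by rewrite cE /GRing.scale/=; ring.
rewrite (integral_itv_FTC ab dH).
  by rewrite /H /cutoff -/c; congr EFin; ring.
move=> s; apply: cvgM.
  by apply: cvgMr; exact: exprn_continuous.
apply: cvgMr.
apply: (@continuous_comp _ _ _ (fun s => - (s ^+ 2 * c)) expR); last exact: continuous_expR.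
by apply: cvgN; apply: cvgMl; exact: exprn_continuous.
Qed.

End Subordination.

(** * The estimate for separated functions *)

Section OffDiagonal.
Variable R : realType.
Implicit Types (x y xi : space3 R) (f g : space3 R -> R[i]) (s t a b delta : R).

Definition L1norm f : R := \int[mu3 R]_x cmod (f x).

Lemma L1norm_ge0 f : 0 <= L1norm f.
Proof. by apply: Rintegral_ge0 => x _; exact: cmod_ge0. Qed.

Definition spectral_product f g xi : R[i] :=
  fourier (-1) f xi * ((fourier (-1) g xi)^*)%C.

Lemma cmeasurable_spectral_product f g : cintegrable (mu3 R) f ->
  cintegrable (mu3 R) g -> cmeasurable (spectral_product f g).
Proof.
move=> [mf _] [mg _]; apply: cmeasurableM; first exact: cmeasurable_fourier.
by apply: cmeasurable_conj; exact: cmeasurable_fourier.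
Qed.

Lemma cmod_spectral_product_le f g xi : cintegrable (mu3 R) f ->
  cintegrable (mu3 R) g -> cmod (spectral_product f g xi) <= L1norm f * L1norm g.
Proof.
move=> fi gi; rewrite cmodM cmod_conj.
by rewrite ler_pM ?cmod_ge0//; exact: cmod_fourier_le.
Qed.

(** Separation of the supports in the plane of the first two coordinates, in a
    form that one-dimensional kernel bounds can use. *)
Definition separated delta f g := forall y x, f y != 0 -> g x != 0 ->
  delta <= `|x.1.1 - y.1.1| \/ delta <= `|x.1.2 - y.1.2|.

Lemma gweight_pairing_far P : exists2 M, 0 <= M & forall s delta f g,
  0 < s -> 0 <= delta -> cintegrable (mu3 R) f -> cintegrable (mu3 R) g ->
  separated delta f g ->
  cmod (cint (mu3 R) (fun xi => (gweight P s xi)%:C%C * spectral_product f g xi)) <=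
    M / s ^+ 3 / (1 + (delta / s) ^+ 4) * (L1norm f * L1norm g).
Proof.
have [M M0 hM] := @gweight_kernel_far R P.
exists M => // s delta f g s0 d0 fi gi sep.
have iW := integrable_gweight P s0.
have [mf fi1] := fi; have [mg gi1] := gi.
set K := M / s ^+ 3 / _.
have K0 : 0 <= K.
  rewrite divr_ge0 ?divr_ge0 ?exprn_ge0 ?(ltW s0)// addr_ge0// (exprM _ 2 2).
  exact: sqr_ge0.
have mcf := measurable_cmod mf; have mcg := measurable_cmod mg.
rewrite -lee_fin; apply: (le_trans (fourier_pairing_le iW fi gi)).
have i2 : (sprod (mu3 R) (mu3 R)).-integrable setT
    (fun p => (cmod (f p.1) * cmod (g p.2))%:E).
  exact: (integrable_sprodM (a := fun x => cmod (f x)) (b := fun x => cmod (g x))).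
have m2 : measurable_fun setT (fun p : space3 R * space3 R => cmod (f p.1) * cmod (g p.2)).
  by apply/measurable_EFinP; exact: measurable_int i2.
apply: (@le_trans _ _ (\int[sprod (mu3 R) (mu3 R)]_p
    (K%:E * (cmod (f p.1) * cmod (g p.2))%:E))%E).
  apply: ge0_le_integral => //.
  - by move=> p _; rewrite lee_fin !mulr_ge0 ?cmod_ge0.
  - apply/measurable_EFinP/measurable_funM => //.
    apply: measurable_cmod; apply: cmeasurable_wkernel.
    exact: measurable_gweight.
  - by apply: measurable_funeM; exact/measurable_EFinP.
  - move=> [y x] _; rewrite -EFinM lee_fin /= mulrC.
    have [->|fy] := eqVneq (f y) 0; first by rewrite cmod0 !(mul0r, mulr0).
    have [->|gx] := eqVneq (g x) 0; first by rewrite cmod0 !(mul0r, mulr0).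
    by rewrite ler_wpM2r ?mulr_ge0 ?cmod_ge0// hM//; exact: sep.
rewrite ge0_integralZl//; first last.
- by move=> p _; rewrite lee_fin mulr_ge0 ?cmod_ge0.
- exact/measurable_EFinP.
rewrite (EFinM K); apply: lee_wpmul2l; first by rewrite lee_fin.
rewrite (ge0_integral_sprodM (mu3 R) (mu3 R) (a := fun x => cmod (f x))
  (b := fun x => cmod (g x)))//; [|by move=> ?; exact: cmod_ge0..].
by rewrite EFinM /L1norm /Rintegral !fineK// integrable_fin_num.
Qed.

(** The left-hand side is [2 / (s ^+ 4 + delta ^+ 4)]. It is at most
    [4 / (s ^+ 2 + delta ^+ 2) ^+ 2], and one of the two factors of this
    denominator is bounded below by [delta ^+ 2], which leaves a profile whose
    integral in [s] is elementary. *)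
Lemma kernel_profile_le s delta : 0 < s -> 0 < delta ->
  2 / s * (1 / s ^+ 3 / (1 + (delta / s) ^+ 4)) <=
    4 / delta ^+ 4 * lorentz (delta^-1) 0 s.
Proof.
move=> s0 d0.
have sN0 : s != 0 by rewrite gt_eqF.
have dN0 : delta != 0 by rewrite gt_eqF.
have p4 : 0 < s ^+ 4 + delta ^+ 4 by rewrite addr_gt0// exprn_gt0.
have p2 : 0 < s ^+ 2 + delta ^+ 2 by rewrite addr_gt0// exprn_gt0.
have -> : 2 / s * (1 / s ^+ 3 / (1 + (delta / s) ^+ 4)) = 2 / (s ^+ 4 + delta ^+ 4).
  by field; rewrite sN0 gt_eqF//= addrC gt_eqF.
have -> : 4 / delta ^+ 4 * lorentz (delta^-1) 0 s = 4 / (delta ^+ 2 * (s ^+ 2 + delta ^+ 2)).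
  by rewrite /lorentz addr0; field; rewrite dN0 gt_eqF//= addrC gt_eqF.
rewrite ler_pdivrMr// mulrAC ler_pdivlMr ?mulr_gt0 ?exprn_gt0//.
rewrite (exprM s 2 2) (exprM delta 2 2).
have : 0 <= s ^+ 2 by exact: sqr_ge0.
have : 0 <= delta ^+ 2 by exact: sqr_ge0.
have := sqr_ge0 (s ^+ 2 - delta ^+ 2).
by move: (s ^+ 2) (delta ^+ 2) => u v; nra.
Qed.

Variables (k h : 'I_3).
Hypothesis hkh : k != h.

(** Each Gaussian weight is paired with its own bound [kernel_profile_le], and the
    bounds are integrated over the whole line: the result does not depend on the
    cutoff and has the decay [delta ^- 3] of the kernel of the multiplier. *)
Lemma off_diagonal : exists2 C, 0 <= C & forall a b delta f g,
  0 < a -> a <= b -> 0 < delta ->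
  cintegrable (mu3 R) f -> cintegrable (mu3 R) g -> separated delta f g ->
  cmod (cint (mu3 R) (fun xi =>
    (riesz_symbol k h xi * cutoff a b xi)%:C%C * spectral_product f g xi)) <=
  C / delta ^+ 3 * (L1norm f * L1norm g).
Proof.
have [M M0 hM] := gweight_pairing_far (riesz_poly R k h).
exists (4 * pi * M) => [|a b delta f g a0 ab d0 fi gi sep].
  by rewrite !mulr_ge0// pi_ge0.
set X := spectral_product f g; set N := L1norm f * L1norm g.
have N0 : 0 <= N by rewrite mulr_ge0 ?L1norm_ge0.
have mX : cmeasurable X by exact: cmeasurable_spectral_product.
have X_le xi : cmod (X xi) <= N by exact: cmod_spectral_product_le.
have b0 : 0 < b by exact: lt_le_trans ab.
(* The superposition of weights is an integral over [[a, b]]; writing it over the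
   whole line with an indicator makes it a product-measure integral. *)
pose I := `[a, b]%classic : set (measurableTypeR R).
have mI : measurable I by exact: measurable_itv.
have iI : (mu1 R).-integrable setT (fun s => (\1_I s)%:E).
  exact: (@integrable_indic_itv R a b true false).
pose e s xi := symbol_num k h xi * expR (- (s ^+ 2 * enorm xi ^+ 2)).
pose w s xi := \1_I s * (2 * s ^+ 3 * e s xi).
have e0 s xi : 0 <= e s xi by rewrite mulr_ge0 ?expR_ge0 ?symbol_num_ge0.
have w_le s xi : `|w s xi| <= \1_I s * (2 * b ^+ 3 * e a xi).
  rewrite /w; have [sI|sI] := boolP (s \in I); last first.
    by rewrite indicE (negPf sI) !mul0r normr0.
  have /andP[as_ sb] : a <= s <= b by move: sI; rewrite inE /I/= ?in_itv.
  have s0 : 0 <= s by rewrite (le_trans (ltW a0)).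
  have s30 : 0 <= 2 * s ^+ 3 by rewrite mulr_ge0// exprn_ge0.
  rewrite indicE sI !mul1r ger0_norm ?(mulr_ge0 s30)//; apply: ler_pM => //.
    by rewrite ler_wpM2l// lerXn2r ?nnegrE// (ltW b0).
  rewrite /e ler_wpM2l ?symbol_num_ge0// ler_expR lerN2 ler_wpM2r ?sqr_ge0//.
  by rewrite lerXn2r ?nnegrE// ltW.
have ie : (mu3 R).-integrable setT (fun xi => (e a xi)%:E).
  have -> : (fun xi => (e a xi)%:E) =
      (fun xi => ((a ^+ 4)^-1)%:E * (gweight (riesz_poly R k h) a xi)%:E)%E.
    apply/funext => xi; rewrite -EFinM gweight_riesz// mulKf// expf_neq0//.
    by rewrite gt_eqF.
  by apply: integrableZl => //; exact: integrable_gweight.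
have mw : measurable_fun setT (fun z : measurableTypeR R * space3 R => w z.1 z.2).
  have m1 : measurable_fun setT (fun z : measurableTypeR R * space3 R => z.1 : R).
    exact: measurable_fst.
  have m2 : measurable_fun setT (fun z : measurableTypeR R * space3 R => z.2).
    exact: measurable_snd.
  apply: measurable_funM.
    have mi : measurable_fun setT (\1_I : measurableTypeR R -> R).
      exact: measurable_indic.
    exact: (measurableT_comp mi measurable_fst).
  apply: measurable_funM.
    by apply: measurable_funM => //; exact: measurable_funX.
  apply: measurable_funM.
    by apply: (measurableT_comp (f := symbol_num k h)) => //; exact: measurable_symbol_num.
  apply: (measurableT_comp (f := expR)); first exact: measurable_expR.
  apply: measurableT_comp => //; apply: measurable_funM; first exact: measurable_funX.
  by apply: (measurableT_comp (f := fun xi : space3 R => enorm xi ^+ 2)) => //;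
    exact: measurable_sqr_enorm.
pose B (z : measurableTypeR R * space3 R) : R[i] := (w z.1 z.2)%:C%C * X z.2.
have iB : cintegrable (sprod (mu1 R) (mu3 R)) B.
  apply: (@le_cintegrable _ _ _ _ _ (fun z => \1_I z.1 * (2 * b ^+ 3 * N * e a z.2))).
  - apply: cmeasurableM; first exact: cmeasurable_real.
    by apply: (cmeasurable_comp mX); exact: measurable_snd.
  - apply: (@integrable_sprodM _ _ _ _ _ (mu1 R) (mu3 R) (fun s => \1_I s)
      (fun xi => 2 * b ^+ 3 * N * e a xi)) => //.
    by under eq_fun do rewrite EFinM; exact: integrableZl.
  - move=> z; rewrite /B cmodM cmod_real.
    rewrite [leRHS](_ : _ = \1_I z.1 * (2 * b ^+ 3 * e a z.2) * N); last by ring.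
    by rewrite ler_pM ?cmod_ge0.
have inner xi : cint (mu1 R) (fun s => B (s, xi)) =
    (riesz_symbol k h xi * cutoff a b xi)%:C%C * X xi.
  have mws : measurable_fun setT (fun s : measurableTypeR R => w s xi).
    exact: (measurableT_comp (f := fun z : measurableTypeR R * space3 R => w z.1 z.2)
      mw (pair2_measurable xi)).
  have iw : cintegrable (mu1 R) (fun s => (w s xi)%:C%C).
    apply: (@le_cintegrable _ (measurableTypeR R) R (mu1 R) _ (fun s => 2 * b ^+ 3 * e a xi * \1_I s)).
    - exact: cmeasurable_real.
    - by under eq_fun do rewrite EFinM; exact: integrableZl.
    - by move=> s; rewrite cmod_real mulrC.
  have -> : cint (mu1 R) (fun s => B (s, xi)) = cint (mu1 R) (fun s => X xi * (w s xi)%:C%C).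
    by apply: eq_cint => s; rewrite mulrC.
  rewrite cintZ// mulrC cint_real; congr (_%:C%C * _).
  rewrite /Rintegral -[RHS]/(fine (_%:E)) -(subordination k h xi ab); congr fine.
  rewrite [RHS]integral_mkcond; apply: eq_integral => s _.
  by rewrite patchE /w indicE; case: ifPn => _; rewrite ?mul1r// mul0r.
rewrite -(eq_cint _ inner) -cint_Fubini//.
have cN0 : 0 <= 4 / delta ^+ 4 * M * N.
  by apply: mulr_ge0 => //; apply: mulr_ge0 => //; rewrite divr_ge0 ?exprn_ge0 ?(ltW d0).
have outer s : cmod (cint (mu3 R) (fun xi => B (s, xi))) <=
    4 / delta ^+ 4 * M * N * lorentz (delta^-1) 0 s.
  have bound_ge0 : 0 <= 4 / delta ^+ 4 * M * N * lorentz (delta^-1) 0 s.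
    by apply: mulr_ge0 => //; exact/ltW/lorentz_gt0.
  have [sI|sI] := boolP (s \in I); last first.
    have -> : cint (mu3 R) (fun xi => B (s, xi)) = cint (mu3 R) (fun=> 0).
      by apply: eq_cint => xi; rewrite /B /w indicE (negPf sI)/= !mul0r.
    by rewrite cint0 cmod0.
  have /andP[as_ sb] : a <= s <= b by move: sI; rewrite inE /I/= ?in_itv.
  have s0 : 0 < s by exact: lt_le_trans as_.
  have iG : cintegrable (mu3 R) (fun xi => (gweight (riesz_poly R k h) s xi)%:C%C * X xi).
    apply: (@le_cintegrable _ _ _ _ _ (fun xi => N * `|gweight (riesz_poly R k h) s xi|)).
    - by apply: cmeasurableM => //; apply: cmeasurable_real; exact: measurable_gweight.
    - under eq_fun do rewrite EFinM.
      by apply: integrableZl => //; exact: (integrable_norm (integrable_gweight _ s0)).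
    - by move=> xi; rewrite cmodM cmod_real mulrC ler_wpM2r.
  have -> : cint (mu3 R) (fun xi => B (s, xi)) = cint (mu3 R)
      (fun xi => (2 / s)%:C%C * ((gweight (riesz_poly R k h) s xi)%:C%C * X xi)).
    apply: eq_cint => xi; rewrite /B mulrA -rmorphM; congr (_%:C%C * _).
    rewrite /w indicE sI mul1r gweight_riesz// -/(e s xi)/=.
    by field; rewrite gt_eqF.
  rewrite cintZ// cmodM cmod_real ger0_norm; last by rewrite divr_ge0// ltW.
  apply: le_trans (ler_wpM2l _ (hM s delta f g s0 (ltW d0) fi gi sep)) _.
    by rewrite divr_ge0// ltW.
  rewrite -/N [leLHS](_ : _ = (M * N) * (2 / s * (1 / s ^+ 3 / (1 + (delta / s) ^+ 4)))).
    rewrite [leRHS](_ : _ = (M * N) * (4 / delta ^+ 4 * lorentz delta^-1 0 s)); last by ring.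
    by apply: ler_wpM2l; [exact: mulr_ge0|exact: kernel_profile_le].
  by ring.
have mo : cmeasurable (fun s => cint (mu3 R) (fun xi => B (s, xi))).
  by apply: cmeasurable_cint_section; case: iB.
apply: (@le_trans _ _ (\int[mu1 R]_s (4 / delta ^+ 4 * M * N * lorentz (delta^-1) 0 s))).
  apply: cmod_cint_le_bound => //.
  under eq_fun do rewrite EFinM.
  by apply: integrableZl => //; apply: integrable_lorentz; rewrite invr_gt0.
rewrite RintegralZl//; last by apply: integrable_lorentz; rewrite invr_gt0.
have d1 : 0 < delta^-1 by rewrite invr_gt0.
apply: (@le_trans _ _ (4 / delta ^+ 4 * M * N * (pi / delta^-1))).
  by rewrite ler_wpM2l ?Rintegral_lorentz_le.
rewrite le_eqVlt; apply/orP; left; apply/eqP.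
have dN0 : delta != 0 by rewrite gt_eqF.
by move: (pi : R) => q; field.
Qed.

End OffDiagonal.

(** * Truncations *)

Section Truncations.
Variable R : realType.
Implicit Types (x y xi : space3 R) (f g phi : space3 R -> R[i]) (A : set (space3 R)).

Definition restr A f x : R[i] := (\1_A x)%:C%C * f x.

Lemma cmod_restr_le A f x : cmod (restr A f x) <= cmod (f x).
Proof.
rewrite cmodM cmod_real indicE ler_piMl ?cmod_ge0//.
by case: (_ \in _); rewrite ?normr1 ?normr0.
Qed.

Lemma restr_neq0 A f x : restr A f x != 0 -> A x /\ f x != 0.
Proof.
rewrite /restr indicE; have [xA|_] := boolP (x \in A).
  by rewrite mul1r => ->; split => //; exact: set_mem.
by rewrite mul0r eqxx.
Qed.

Lemma cmeasurable_restr A f : measurable A -> cmeasurable f ->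
  cmeasurable (restr A f).
Proof.
move=> mA mf; apply: cmeasurableM => //; apply: cmeasurable_real.
exact: measurable_indic.
Qed.

Lemma cintegrable_restr A f : measurable A -> cintegrable (mu3 R) f ->
  cintegrable (mu3 R) (restr A f).
Proof.
move=> mA [mf fi]; apply: (@le_cintegrable _ _ _ _ _ (fun x => cmod (f x))) => //.
  exact: cmeasurable_restr.
by move=> x; exact: cmod_restr_le.
Qed.

Lemma L1norm_restr_le A f : measurable A -> cintegrable (mu3 R) f ->
  L1norm (restr A f) <= L1norm f.
Proof.
move=> mA fi; have [_ i1] := cintegrable_restr mA fi; have [_ i2] := fi.
by apply: le_Rintegral => // x _; exact: cmod_restr_le.
Qed.

Lemma restr_ae_eq A f : supported_in A f ->
  {ae mu3 R, forall x, f x = restr A f x}.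
Proof.
apply: filterS => x fA; rewrite /restr indicE.
have [_|/negP xA] := boolP (x \in A); first by rewrite mul1r.
by rewrite mul0r fA// => Ax; apply: xA; exact: mem_set.
Qed.

Lemma cintegral_restr A f : cintegral A f = cint (mu3 R) (restr A f).
Proof.
have E (F : space3 R -> R) : \int[leb3 R]_(x in A) F x = \int[mu3 R]_x (\1_A x * F x).
  rewrite Rintegral_mkcond; apply: eq_Rintegral => x _.
  by rewrite patchE indicE; case: ifPn => _; rewrite ?mul1r// mul0r.
rewrite /cintegral !E; apply/eqP; rewrite eq_complex /=.
by apply/andP; split; apply/eqP; apply: eq_Rintegral => x _;
  rewrite /restr ?ReM ?ImM/= mul0r ?subr0 ?addr0.
Qed.

Definition ball3 (n : nat) : set (space3 R) := [set x | enorm x <= n%:R].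

Lemma measurable_ball3 n : measurable (ball3 n).
Proof.
have -> : ball3 n = (fun x => enorm x ^+ 2) @^-1` `]-oo, (n%:R ^+ 2)]%classic.
  apply/seteqP; split => x /=; rewrite /ball3/= in_itv/= ler_pXn2r ?nnegrE//;
  by rewrite /enorm sqrtr_ge0.
by rewrite -[X in measurable X]setTI; apply: measurable_sqr_enorm.
Qed.

Lemma trunc_fourierE (c : R) n f : trunc_fourier c n f = fourier c (restr (ball3 n) f).
Proof.
apply/funext => xi; rewrite /trunc_fourier -/(ball3 n) cintegral_restr.
by apply: eq_cint => x; rewrite /restr mulrA.
Qed.

Lemma fourier_ae_eq (c : R) f g : cmeasurable f -> cmeasurable g ->
  {ae mu3 R, forall x, f x = g x} -> fourier c f = fourier c g.
Proof.
move=> mf mg fg; apply/funext => xi.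
have mph : cmeasurable (fun x => cis (2 * pi * c * dot x xi)).
  by apply: cmeasurable_phase => //; exact: measurable_id.
apply: ae_eq_cint; [exact: cmeasurableM|exact: cmeasurableM|].
by apply: filterS fg => x ->.
Qed.

(** A Gaussian bounds the indicator of a ball from above, up to a constant. *)
Lemma csquare_integrable_indic_ball n :
  csquare_integrable (mu3 R) (fun x => (\1_(ball3 n) x)%:C%C).
Proof.
have mi : measurable_fun setT (\1_(ball3 n) : space3 R -> R).
  by apply: measurable_indic; exact: measurable_ball3.
split; first exact: cmeasurable_real.
apply/L2norm_lty.
pose W := gweight (fun=> 1%:P) 1 : space3 R -> R.
have WE x : W x = expR (- enorm x ^+ 2).
  by rewrite /W gweightE big1 ?mul1r ?expr1n ?mul1r// => j _; rewrite hornerC.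
have iW : (mu3 R).-integrable setT (fun x => (expR (n%:R ^+ 2) * W x)%:E).
  under eq_fun do rewrite EFinM.
  by apply: integrableZl => //; exact: integrable_gweight.
have /integrableP[_] := iW; apply: le_lt_trans.
apply: ge0_le_integral => //.
- by move=> x _; rewrite lee_fin sqr_ge0.
- by apply/measurable_EFinP/measurable_funX; apply: measurable_cmod; exact: cmeasurable_real.
- by apply: measurableT_comp => //; exact: measurable_int iW.
- move=> x _; rewrite abse_EFin lee_fin cmod_real WE -expRD.
  rewrite [leRHS]ger0_norm ?expR_ge0// indicE.
  have [xB|_] := boolP (x \in _); last by rewrite normr0 expr0n expR_ge0.
  rewrite normr1 expr1n -[leLHS](expR0 R) ler_expR subr_ge0.
  move: xB; rewrite inE /ball3/= => xB.
  have e0 : 0 <= enorm x by exact: sqrtr_ge0.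
  by rewrite lerXn2r ?nnegrE.
Qed.

(** Transposing the Fourier transform from one factor of an inner product to the
    other is Fubini's theorem. *)
Lemma fourier_transpose phi g : cintegrable (mu3 R) phi -> cintegrable (mu3 R) g ->
  cint (mu3 R) (fun x => fourier 1 phi x * ((g x)^*)%C) =
  cint (mu3 R) (fun xi => phi xi * ((fourier (-1) g xi)^*)%C).
Proof.
move=> ip ig; have [mp p1] := ip; have [mg g1] := ig.
pose B (z : space3 R * space3 R) : R[i] :=
  phi z.2 * ((g z.1)^*)%C * cis (2 * pi * 1 * dot z.2 z.1).
have m1 : measurable_fun setT (fun z : space3 R * space3 R => z.1).
  exact: measurable_fst.
have m2 : measurable_fun setT (fun z : space3 R * space3 R => z.2).
  exact: measurable_snd.
have iB : cintegrable (sprod (mu3 R) (mu3 R)) B.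
  apply: (@le_cintegrable _ _ _ _ _ (fun z => cmod (g z.1) * cmod (phi z.2))).
  - apply: cmeasurableM; last exact: cmeasurable_phase.
    apply: cmeasurableM; first exact: (cmeasurable_comp mp).
    by apply: cmeasurable_conj; exact: (cmeasurable_comp mg).
  - exact: (integrable_sprodM (a := fun x => cmod (g x)) (b := fun x => cmod (phi x))).
  - by move=> z; rewrite !cmodM cmod_cis mulr1 cmod_conj mulrC.
have E1 x : fourier 1 phi x * ((g x)^*)%C = cint (mu3 R) (fun xi => B (x, xi)).
  rewrite mulrC -cintZ; last exact: cintegrable_fourier.
  by apply: eq_cint => xi; rewrite /B/=; ring.
have E2 xi : phi xi * ((fourier (-1) g xi)^*)%C = cint (mu3 R) (fun x => B (x, xi)).
  have i2 := cintegrable_fourier (-1) xi ig.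
  rewrite -cint_conj// -cintZ; last exact: cintegrable_conj.
  apply: eq_cint => x; rewrite /B conjM conj_cis mulrA; congr (_ * cis _).
  by rewrite !dotE/=; ring.
by rewrite (eq_cint _ E1) (eq_cint _ E2) cint_Fubini.
Qed.

(** [psi t <= 4 / t] because [expR t] exceeds [1 + t ^+ 2 / 2]. *)
Lemma cvg_psi_infty (r : R) : 0 < r ->
  psi (n.+1%:R ^+ 2 * r ^+ 2) @[n --> \oo] --> (0 : R).
Proof.
move=> r0; pose K := 4 / r ^+ 2.
have K0 : 0 <= K by rewrite divr_ge0 ?sqr_ge0.
have cK : K * harmonic n @[n --> \oo] --> (0 : R).
  by rewrite -[0](mulr0 K); apply: cvgMr; exact: cvg_harmonic.
apply: (@squeeze_cvgr _ _ _ _ (cst 0) (fun n => K * harmonic n)) => //; last exact: cvg_cst.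
apply: nearW => n; apply/andP; split.
  by apply: psi_ge0; apply: mulr_ge0; exact: sqr_ge0.
set t := _ * _.
have n1 : 1 <= n.+1%:R :> R by rewrite ler1n.
have t0 : 0 < t by rewrite mulr_gt0// exprn_gt0// ltr0n.
have psi_le : psi t <= 4 / t.
  rewrite /psi expRN ler_pdivrMr ?expR_gt0// mulrAC ler_pdivlMr//.
  have := expR_ge1Dxn 1 (ltW t0); rewrite (_ : 2`! = 2)//; move: (expR t) => E hE.
  by nra.
apply: (le_trans psi_le); rewrite /K -mulrA ler_wpM2l// /harmonic/=.
rewrite -invfM lef_pV2 ?posrE// ?mulr_gt0 ?exprn_gt0 ?ltr0n//.
by rewrite /t mulrC ler_wpM2r ?sqr_ge0// expr2 ler_peMl// ltW.
Qed.


End Truncations.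

(** * The multiplier and its truncations *)

Section Assembly.
Variable R : realType.
Implicit Types (x y xi : space3 R) (f g u F : space3 R -> R[i]).

Lemma continuous_psi : continuous (@psi R).
Proof.
move=> t; apply: cvgM; first by apply: cvgD; [exact: cvg_cst|exact: cvg_id].
apply: (@continuous_comp _ _ _ (fun t : R => - t) (@expR R)); last exact: continuous_expR.
by apply: cvgN; exact: cvg_id.
Qed.

Lemma cvg_cutoff xi : 0 < enorm xi ->
  cutoff (n.+1%:R^-1) n.+1%:R xi @[n --> \oo] --> (1 : R).
Proof.
move=> e0; rewrite -[X in _ --> X]subr0; apply: cvgB; last exact: cvg_psi_infty.
have h1 : (fun n => n.+1%:R^-1 : R) @ \oo --> (0 : R) by exact: cvg_harmonic.
have h2 : (fun n => n.+1%:R^-1 ^+ 2 * enorm xi ^+ 2 : R) @ \oo --> (0 : R).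
  have -> : (0 : R) = 0 ^+ 2 * enorm xi ^+ 2 by rewrite expr0n mul0r.
  apply: cvgMl.
  exact: (@cvg_comp _ _ _ _ (fun x : R => x ^+ 2) _ _ _ h1 (@exprn_continuous R 2 0)).
have psi0 : psi (0 : R) = 1 by rewrite /psi addr0 oppr0 expR0 mulr1.
by have := @cvg_comp _ _ _ _ (@psi R) _ _ _ h2 (@continuous_psi 0); rewrite psi0.
Qed.

Lemma measurable_cutoff (a b : R) : measurable_fun setT (cutoff a b).
Proof.
have mpsi : measurable_fun setT (@psi R).
  by apply: continuous_measurable_fun; exact: continuous_psi.
have m2 (c : R) : measurable_fun setT (fun xi => c * enorm xi ^+ 2).
  by apply: measurable_funM => //; exact: measurable_sqr_enorm.
apply: measurable_funB; first exact: (measurableT_comp mpsi (m2 _)).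
exact: (measurableT_comp mpsi (m2 _)).
Qed.

Lemma in_Lp1_cintegrable f : in_Lp 1 f -> cintegrable (mu3 R) f.
Proof.
move=> [m1 m2]; rewrite /Lp_norm Lnorm1 => h.
split; first by split.
apply/integrableP; split => //.
by apply/measurable_EFinP; apply: measurable_cmod; split.
Qed.

Lemma Lp_norm1 f : cintegrable (mu3 R) f -> Lp_norm 1 f = (L1norm f)%:E.
Proof.
move=> [_ fi]; rewrite /Lp_norm Lnorm1 /L1norm /Rintegral fineK; last first.
  exact: (integrable_fin_num _ fi).
by apply: eq_integral => x _; rewrite abse_EFin ger0_norm// cmod_ge0.
Qed.

Lemma in_Lp2_csquare_integrable f : in_Lp 2 f -> csquare_integrable (mu3 R) f.
Proof. by case=> m1 m2 h; split=> //; split. Qed.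

Lemma cylnorm_cmod x : cylnorm x = cmod (x.1.1 +i* x.1.2)%C.
Proof. by rewrite cmodE. Qed.

(** The two points are at distance at least [r2 - r1] in the plane, so at least one
    of their two coordinates differs by half of it. *)
Lemma cylnorm_separated (r1 r2 : R) x y : cylnorm x <= r1 -> r2 <= cylnorm y ->
  (r2 - r1) / 2 <= `|x.1.1 - y.1.1| \/ (r2 - r1) / 2 <= `|x.1.2 - y.1.2|.
Proof.
rewrite !cylnorm_cmod => hx hy.
have [|h1] := leP ((r2 - r1) / 2) `|x.1.1 - y.1.1|; first by left.
have [|h2] := leP ((r2 - r1) / 2) `|x.1.2 - y.1.2|; first by right.
pose zx : R[i] := (x.1.1 +i* x.1.2)%C; pose zy : R[i] := (y.1.1 +i* y.1.2)%C.
have : cmod zy <= cmod zx + cmod (zy - zx).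
  by have := cmodD zx (zy - zx); rewrite addrC subrK.
have : cmod (zy - zx) <= `|y.1.1 - x.1.1| + `|y.1.2 - x.1.2|.
  exact: cmod_le_add.
rewrite (distrC y.1.1) (distrC y.1.2) => hd hz; exfalso.
have : r2 < r2.
  apply: (le_lt_trans hy); apply: (le_lt_trans hz).
  apply: (le_lt_trans (lerD hx hd)).
  rewrite -ltrBrDl; apply: (lt_le_trans (ltrD h1 h2)).
  by rewrite -splitr.
by rewrite ltxx.
Qed.

Lemma measurable_cylnorm : measurable_fun setT (@cylnorm R).
Proof.
have mid : measurable_fun [set: space3 R] (fun xi => xi) by exact: measurable_id.
have -> : @cylnorm R = fun x => cmod (x.1.1 +i* x.1.2)%C.
  by apply/funext => x; exact: cylnorm_cmod.
apply: measurable_cmod; split; first exact: (measurable_x1 mid).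
exact: (measurable_x2 mid).
Qed.

Lemma measurable_cyl_le (r : R) : measurable [set x : space3 R | cylnorm x <= r].
Proof.
have -> : [set x : space3 R | cylnorm x <= r] = @cylnorm R @^-1` `]-oo, r]%classic.
  by apply/seteqP; split => x /=; rewrite in_itv.
by rewrite -[X in measurable X]setTI; apply: measurable_cylnorm.
Qed.

Lemma measurable_cyl_ge (r : R) : measurable [set x : space3 R | r <= cylnorm x].
Proof.
have -> : [set x : space3 R | r <= cylnorm x] = @cylnorm R @^-1` `[r, +oo[%classic.
  by apply/seteqP; split => x /=; rewrite in_itv/= andbT.
by rewrite -[X in measurable X]setTI; apply: measurable_cylnorm.
Qed.

Variables (k h : 'I_3).
Local Notation m := (riesz_symbol k h).

Lemma csquare_integrable_bounded_mul (c : space3 R -> R) f :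
  measurable_fun setT c -> (forall x, `|c x| <= 1) ->
  csquare_integrable (mu3 R) f -> csquare_integrable (mu3 R) (fun x => (c x)%:C%C * f x).
Proof.
move=> mc c1 fi; have [mf _] := fi.
apply: (le_csquare_integrable _ _ fi).
  by apply: cmeasurableM => //; exact: cmeasurable_real.
by move=> x; rewrite cmodM cmod_real ler_piMl ?cmod_ge0.
Qed.

(** On each ball the inverse Fourier transform can be moved onto [g] by Fubini's
    theorem. As the balls grow, the left-hand sides converge because [u] is a limit
    in square norm, and the right-hand sides by dominated convergence, since [F]
    and the Fourier transform of [g] are square integrable. *)
Lemma inner_multiplier F u g : csquare_integrable (mu3 R) F ->
  cintegrable (mu3 R) g -> csquare_integrable (mu3 R) g ->
  is_fourier_L2 1 (fun xi => (m xi)%:C%C * F xi) u ->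
  inner u g = cint (mu3 R) (fun xi =>
    (m xi)%:C%C * (F xi * ((fourier (-1) g xi)^*)%C)).
Proof.
move=> F2 gi g2 [_ /in_Lp2_csquare_integrable u2 cvu].
have gh2 := csquare_integrable_fourier gi g2.
have [mg _] := gi.
have cg2 : csquare_integrable (mu3 R) (fun x => (g x)^*)%C.
  apply: (le_csquare_integrable _ _ g2); first exact: cmeasurable_conj.
  by move=> x; rewrite cmod_conj.
have cgh2 : csquare_integrable (mu3 R) (fun xi => (fourier (-1) g xi)^*)%C.
  apply: (le_csquare_integrable _ _ gh2); first by apply: cmeasurable_conj; case: gh2.
  by move=> x; rewrite cmod_conj.
pose mF xi := (m xi)%:C%C * F xi.
have mF2 : csquare_integrable (mu3 R) mF.
  apply: csquare_integrable_bounded_mul => //; first exact: measurable_riesz_symbol.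
  by move=> xi; exact: normr_riesz_symbol_le1.
have [mmF _] := mF2.
have mB n := @measurable_ball3 R n.
have irestr n : cintegrable (mu3 R) (restr (ball3 n) mF).
  exact: (csquare_integrableM (@csquare_integrable_indic_ball R n) mF2).1.
have [iH _] := csquare_integrableM mF2 cgh2.
have -> : cint (mu3 R) (fun xi => (m xi)%:C%C * (F xi * ((fourier (-1) g xi)^*)%C)) =
    cint (mu3 R) (fun xi => mF xi * ((fourier (-1) g xi)^*)%C).
  by apply: eq_cint => xi; rewrite /mF mulrA.
apply: (@cmod_cvg_unique R (fun n => cint (mu3 R)
  (fun x => trunc_fourier 1 n mF x * ((g x)^*)%C))).
  apply: (cvg_cint_L2 u2 _ cg2 cvu) => n; rewrite trunc_fourierE.
  by apply: cmeasurable_fourier; exact: cmeasurable_restr.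
have -> : (fun n => cmod (cint (mu3 R) (fun x => trunc_fourier 1 n mF x * ((g x)^*)%C) -
    cint (mu3 R) (fun xi => mF xi * ((fourier (-1) g xi)^*)%C))) =
    (fun n => cmod (cint (mu3 R) (fun xi => (\1_(ball3 n) xi)%:C%C *
      (mF xi * ((fourier (-1) g xi)^*)%C)) -
    cint (mu3 R) (fun xi => mF xi * ((fourier (-1) g xi)^*)%C))).
  apply/funext => n; congr (cmod (_ - _)).
  rewrite trunc_fourierE fourier_transpose//.
  by apply: eq_cint => xi; rewrite /restr mulrA.
apply: cint_dominated_cvg => //.
- by move=> n; exact: measurable_indic.
- by move=> n x; rewrite indicE; case: (_ \in _); rewrite ?normr1 ?normr0.
- move=> x _; apply: cvg_near_cst; exists (Num.Def.trunc (enorm x)).+1 => // n /= xn.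
  rewrite indicE mem_set//= /ball3/= (le_trans (ltW (truncnS_gt _)))//.
  by rewrite ler_nat.
Qed.

Hypothesis hkh : k != h.

(** [F] is known only as a limit in square norm, so the bound is transported from
    the truncations of [f] to [F] with the spectral cutoff in place, and the cutoff
    is removed afterwards. Both limits preserve a bound that is uniform in the
    truncation and in the cutoff. *)
Lemma multiplier_pairing_le : exists2 C : R, 0 <= C & forall delta f F g,
  0 < delta ->
  cintegrable (mu3 R) f -> cintegrable (mu3 R) g -> csquare_integrable (mu3 R) g ->
  separated delta f g -> is_fourier_L2 (-1) f F ->
  cmod (cint (mu3 R) (fun xi =>
    (m xi)%:C%C * (F xi * ((fourier (-1) g xi)^*)%C))) <=
  C / delta ^+ 3 * (L1norm f * L1norm g).
Proof.
have [C C0 hC] := @off_diagonal R k h hkh.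
exists C => // delta f F g d0 fi gi g2 sep [_ /in_Lp2_csquare_integrable F2 cvF].
have [mf _] := fi.
have gh2 := csquare_integrable_fourier gi g2.
have cgh2 : csquare_integrable (mu3 R) (fun xi => (fourier (-1) g xi)^*)%C.
  apply: (le_csquare_integrable _ _ gh2); first by apply: cmeasurable_conj; case: gh2.
  by move=> x; rewrite cmod_conj.
have mm := @measurable_riesz_symbol R k h.
have m1 xi : `|m xi : R| <= 1 by exact: normr_riesz_symbol_le1.
have mF2 := csquare_integrable_bounded_mul mm m1 F2.
have [iH _] := csquare_integrableM mF2 cgh2.
pose H xi := (m xi)%:C%C * F xi * ((fourier (-1) g xi)^*)%C.
have -> : cint (mu3 R) (fun xi => (m xi)%:C%C * (F xi * ((fourier (-1) g xi)^*)%C)) =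
    cint (mu3 R) H.
  by apply: eq_cint => xi; rewrite /H mulrA.
pose phi n := cutoff (n.+1%:R^-1 : R) n.+1%:R.
have phi1 n xi : `|phi n xi| <= 1 by exact: normr_cutoff_le1.
have mphi n : measurable_fun setT (phi n) by exact: measurable_cutoff.
apply: (@cmod_cvg_le R (fun n => cint (mu3 R) (fun xi => (phi n xi)%:C%C * H xi))).
  apply: cint_dominated_cvg => // xi.
  rewrite /H; have [e0|e0 _] := eqVneq (enorm xi) 0.
    by rewrite /riesz_symbol e0 expr0n/= invr0 mulr0 !mul0r eqxx.
  by apply: cvg_cutoff; rewrite lt_neqAle eq_sym e0 sqrtr_ge0.
move=> n.
pose w xi := (m xi * phi n xi)%:C%C * ((fourier (-1) g xi)^*)%C.
have w2 : csquare_integrable (mu3 R) w.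
  apply: csquare_integrable_bounded_mul => //; first exact: measurable_funM.
  by move=> xi; rewrite normrM mulr_ile1.
have -> : cint (mu3 R) (fun xi => (phi n xi)%:C%C * H xi) =
    cint (mu3 R) (fun xi => F xi * w xi).
  apply: eq_cint => xi; rewrite /H /w.
  have -> : (m xi * phi n xi)%:C%C = (m xi)%:C%C * (phi n xi)%:C%C by exact: rmorphM.
  ring.
have mB N := @measurable_ball3 R N.
apply: (@cmod_cvg_le R (fun N => cint (mu3 R)
  (fun xi => trunc_fourier (-1) N f xi * w xi))).
  apply: (cvg_cint_L2 F2 _ w2 cvF) => N; rewrite trunc_fourierE.
  by apply: cmeasurable_fourier; exact: cmeasurable_restr.
move=> N; rewrite trunc_fourierE.
have fiN := cintegrable_restr (mB N) fi.
have sepN : separated delta (restr (ball3 N) f) g.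
  by move=> y x /restr_neq0[_ fy]; exact: sep.
have -> : cint (mu3 R) (fun xi => fourier (-1) (restr (ball3 N) f) xi * w xi) =
  cint (mu3 R) (fun xi => (m xi * cutoff (n.+1%:R^-1) n.+1%:R xi)%:C%C *
    spectral_product (restr (ball3 N) f) g xi).
  by apply: eq_cint => xi; rewrite /w /spectral_product -/(phi n xi); ring.
apply: (le_trans (hC _ _ delta _ _ _ _ d0 fiN gi sepN)).
- by rewrite invr_gt0 ltr0n.
- by apply: (@le_trans _ _ 1); rewrite ?invf_le1 ?ltr0n// ler1n.
- rewrite ler_wpM2l ?divr_ge0 ?exprn_ge0 ?(ltW d0)// ler_wpM2r ?L1norm_ge0//.
  exact: L1norm_restr_le.
Qed.

End Assembly.

Unset Implicit Arguments.

Theorem proposition2p7 (R : realType) (k h : 'I_3) (hkh : k != h)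
    (gamma1 gamma2 : R) (hgamma1 : 0 < gamma1) (hgamma2 : 0 < gamma2)
    (hd : 0 < gamma2 - gamma1) (rho0 : R) (hrho0 : 0 < rho0) :
  exists2 C : R, 0 < C &
    forall (rho : R) (f g u : space3 R -> R[i]),
      rho0 <= rho ->
      in_Lp 1 f -> in_Lp 2 f -> in_Lp 1 g -> in_Lp 2 g ->
      supported_in [set x | gamma2 * rho <= cylnorm x] f ->
      supported_in [set x | cylnorm x <= gamma1 * rho] g ->
      is_fourier_multiplier (riesz_symbol k h) f u ->
      ((cmod (inner u g))%:E <=
         (C * rho^-1)%:E * Lp_norm 1 g * Lp_norm 1 f)%E.
Proof.
have [C C0 hC] := @multiplier_pairing_le R k h hkh.
set d := gamma2 - gamma1.
(* The estimate decays like [rho ^- 3]; two powers of [rho] are given up against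
   [rho0]. The added 1 makes the constant positive. *)
exists (C / ((d / 2) ^+ 3 * rho0 ^+ 2) + 1).
  by rewrite ltr_wpDl// divr_ge0// mulr_ge0 ?exprn_ge0// ltW// divr_gt0.
move=> rho f g u hrho f1 f2 g1 g2 sf sg [F hF hu].
have rho_gt0 : 0 < rho := lt_le_trans hrho0 hrho.
have fi := in_Lp1_cintegrable f1; have gi := in_Lp1_cintegrable g1.
have g2' := in_Lp2_csquare_integrable g2.
set A := [set x : space3 R | gamma2 * rho <= cylnorm x] in sf.
set B := [set x : space3 R | cylnorm x <= gamma1 * rho] in sg.
have mA : measurable A by exact: measurable_cyl_ge.
have mB : measurable B by exact: measurable_cyl_le.
(* Replacing [f] and [g] by their restrictions turns the almost everywhere support
   conditions into conditions at every point. *)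
have fAi := cintegrable_restr mA fi; have gBi := cintegrable_restr mB gi.
have [mf _] := fi; have [mg _] := gi; have [mfA _] := fAi; have [mgB _] := gBi.
have gB2 : csquare_integrable (mu3 R) (restr B g).
  by apply: (le_csquare_integrable mgB _ g2') => x; exact: cmod_restr_le.
have fAf : {ae mu3 R, forall x, f x = restr A f x} by exact: restr_ae_eq.
have gBg : {ae mu3 R, forall x, g x = restr B g x} by exact: restr_ae_eq.
have hFA : is_fourier_L2 (-1) (restr A f) F.
  have [f2' F2 cvF] := hF.
  have [[mfA1 mfA2] fA2] : csquare_integrable (mu3 R) (restr A f).
    apply: (le_csquare_integrable mfA _ (in_Lp2_csquare_integrable f2)) => x.
    exact: cmod_restr_le.
  split=> //.
  have E n : trunc_fourier (-1) n (restr A f) = trunc_fourier (-1) n f.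
    rewrite !trunc_fourierE; apply: fourier_ae_eq.
    - by apply: cmeasurable_restr => //; exact: measurable_ball3.
    - by apply: cmeasurable_restr => //; exact: measurable_ball3.
    - by apply: filterS fAf => x fx; rewrite /restr -/(restr A f x) -fx.
  by under eq_fun do rewrite E.
have innerE : inner u g = inner u (restr B g).
  have [_ /in_Lp2_csquare_integrable[mu _] _] := hu.
  apply: (@ae_eq_cint _ _ _ (mu3 R)).
  - by apply: cmeasurableM => //; exact: cmeasurable_conj.
  - by apply: cmeasurableM => //; exact: cmeasurable_conj.
  - by apply: filterS gBg => x <-.
have [_ /in_Lp2_csquare_integrable F2 _] := hF.
rewrite innerE (inner_multiplier F2 gBi gB2 hu).
have sep : separated (d / 2 * rho) (restr A f) (restr B g).
  move=> y x /restr_neq0[Ay _] /restr_neq0[Bx _].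
  have -> : d / 2 * rho = (gamma2 * rho - gamma1 * rho) / 2 by rewrite /d; field.
  exact: cylnorm_separated.
have dr0 : 0 < d / 2 * rho by rewrite mulr_gt0// divr_gt0.
have main := hC _ _ _ _ dr0 fAi gBi gB2 sep hFA.
rewrite !Lp_norm1// -!EFinM lee_fin; apply: (le_trans main).
have nf := L1norm_restr_le mA fi; have ng := L1norm_restr_le mB gi.
have -> : (C / ((d / 2) ^+ 3 * rho0 ^+ 2) + 1) * rho^-1 * L1norm g * L1norm f =
  (C / ((d / 2) ^+ 3 * rho0 ^+ 2) + 1) * rho^-1 * (L1norm f * L1norm g) by ring.
apply: ler_pM.
- by rewrite divr_ge0// exprn_ge0// ltW.
- by rewrite mulr_ge0 ?L1norm_ge0.
- rewrite exprMn [leLHS](_ : _ = C / ((d / 2) ^+ 3 * rho ^+ 2) * rho^-1); last first.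
    by field; rewrite gt_eqF//= gt_eqF.
  rewrite ler_wpM2r ?invr_ge0 ?(ltW rho_gt0)//.
  have d3 : 0 < (d / 2) ^+ 3 by rewrite exprn_gt0// divr_gt0.
  rewrite (le_trans (y := C / ((d / 2) ^+ 3 * rho0 ^+ 2)))//; last by rewrite lerDl.
  rewrite ler_wpM2l// lef_pV2 ?posrE ?mulr_gt0 ?exprn_gt0// ler_pM2l//.
  by rewrite lerXn2r ?nnegrE ?(ltW hrho0) ?(ltW rho_gt0).
- by rewrite ler_pM ?L1norm_ge0.
Qed.
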